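(* Let $\mathbb{K}$ be a field and let $I\subset\mathbb{K}[x_1,\ldots,x_m]$ and $J\subset\mathbb{K}[y_1,\ldots,y_n]$ be nonzero proper ideals. Then, for $IJ\subset\mathbb{K}[x_1,\ldots,x_m,y_1,\ldots,y_n]$ (the product of the extensions of $I$ and $J$ to this polynomial ring in the disjoint sets of variables): (1) $\rho(IJ)=\max\{\rho(I),\rho(J)\}$. (2) $\rho_a(IJ)=\max\{\rho_a(I),\rho_a(J)\}$.
   Context: For an ideal $I$ in a Noetherian ring $R$, $I^{(s)}=\bigcap_{P\in\mathrm{Ass}(I)}(I^sR_P\cap R)$ is the $s$-th symbolic power. The resurgence and asymptotic resurgence are $\rho(I)=\sup\{s/t : s,t\in\mathbb{N},\ I^{(s)}\not\subset I^t\}$ and $\rho_a(I)=\sup\{s/t : s,t\in\mathbb{N},\ I^{(sr)}\not\subset I^{tr}\text{ for all } r\gg0\}$, where $\mathbb{N}$ denotes the positive integers. *)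

(* Defs.v *)
From HB Require Import structures.
From mathcomp Require Import all_boot all_order all_algebra.
From mathcomp Require Import mpoly.
From mathcomp Require Import classical_sets reals constructive_ereal ereal.

Set Implicit Arguments.
Unset Strict Implicit.
Unset Printing Implicit Defensive.

Import Order.TTheory GRing.Theory Num.Theory.
Local Open Scope classical_set_scope.
Local Open Scope ring_scope.

(* [ideal_of A M]: M is an ideal of the subring A of R. Taking A = setT gives
   the ideals of R, not necessarily proper or nonzero. The general A is used
   for localizations, which are subrings of a fraction field. *)
Definition ideal_of (R : comNzRingType) (A M : set R) : Prop :=
  [/\ M `<=` A, M 0 &
      forall a u v : R, A a -> M u -> M v -> M (a * u + v)].

Definition ideal_span (R : comNzRingType) (A G : set R) : set R :=
  smallest (ideal_of A) G.

Definition ideal (R : comNzRingType) (I : set R) : Prop := ideal_of setT I.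

Definition prime_ideal (R : comNzRingType) (P : set R) : Prop :=
  [/\ ideal P, ~ P 1 & forall a b : R, P (a * b) -> P a \/ P b].

Definition ideal_mul (R : comNzRingType) (I J : set R) : set R :=
  ideal_span setT [set a * b | a in I & b in J].

Definition ideal_pow (R : comNzRingType) (I : set R) (s : nat) : set R :=
  iter s (ideal_mul I) setT.

(* The associated primes of the R-module R / I: the primes that are the
   annihilator of the class of some f. *)
Definition Ass (R : comNzRingType) (I : set R) : set (set R) :=
  [set P | prime_ideal P /\ exists f : R, P = [set a | I (a * f)]].

(* The local ring R_P of a domain R, as a subring of its fraction field. *)
Definition localization (R : idomainType) (P : set R) : set {fraction R} :=
  [set tofrac a / tofrac b | a in setT & b in ~` P].

(* The ideal J R_P of R_P. *)
Definition loc_ideal (R : idomainType) (P J : set R) : set {fraction R} :=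
  ideal_span (localization P) (@tofrac R @` J).

Definition symbolic_pow (R : idomainType) (I : set R) (s : nat) : set R :=
  \bigcap_(P in Ass I) (@tofrac R @^-1` loc_ideal P (ideal_pow I s)).

(* Suprema are taken in the extended reals, so that no boundedness is built in
   and an unbounded set of quotients gives +oo. *)
Definition resurgence (F : realType) (R : idomainType) (I : set R) : \bar F :=
  ereal_sup [set x | exists s t : nat,
    [/\ (0 < s)%N, (0 < t)%N,
        ~ (symbolic_pow I s `<=` ideal_pow I t) &
        x = (s%:R / t%:R)%:E]].

Definition asymptotic_resurgence (F : realType) (R : idomainType)
    (I : set R) : \bar F :=
  ereal_sup [set x | exists s t : nat,
    [/\ (0 < s)%N, (0 < t)%N,
        exists r0 : nat, forall r : nat, (r0 <= r)%N ->
          ~ (symbolic_pow I (s * r) `<=` ideal_pow I (t * r)) &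
        x = (s%:R / t%:R)%:E]].

(* In K[z_1, ..., z_(m + n)] the first m variables play the role of the x_i
   and the last n that of the y_j. *)
Definition inj_x (K : fieldType) (m n : nat) (p : {mpoly K[m]}) :
    {mpoly K[m + n]} :=
  comp_mpoly [tuple 'X_(lshift n i) | i < m] p.

Definition inj_y (K : fieldType) (m n : nat) (p : {mpoly K[n]}) :
    {mpoly K[m + n]} :=
  comp_mpoly [tuple 'X_(rshift m j) | j < n] p.

Definition extension (R S : comNzRingType) (f : R -> S) (I : set R) : set S :=
  ideal_span setT (f @` I).

Definition mixed_product (K : fieldType) (m n : nat)
    (I : set {mpoly K[m]}) (J : set {mpoly K[n]}) : set {mpoly K[m + n]} :=
  ideal_mul (extension (@inj_x K m n) I) (extension (@inj_y K m n) J).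

(* Main.v *)
(** Write A = K[x], B = K[y], R = K[x, y], and let M be the product of the
    extensions of I and J, which is also their intersection. The associated
    primes of M are extended from those of I and of J, by McCoy's theorem, and
    this gives: M^(s) is contained in M^t if and only if I^(s) is contained in
    I^t and J^(s) in J^t. So (1) is the supremum of a union.

    For (2) the difficulty is that, for a given slope s/t, the inclusion could
    fail for I and for J along complementary sets of r. This is excluded by
    integral closure: if I^(s'r) lies in I^(t'r) for infinitely many r and
    s'/t' < s/t, then every f in I^(sr) has a power f^k in I^(Nk) with N larger
    than tr by any given constant, for r large; and if I has l generators, then
    f^k in I^(Nk) implies f in I^(N - l).

    The last fact has a tight closure proof over a field of characteristic p:
    c f^q lies in the ideal generated by the q-th powers of I^(N - l), for some
    c <> 0 and all large q = p^e, and extracting q-th roots along a monomial of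
    c gives f. In this proof the degrees of the coefficients are bounded
    independently of q, so a counterexample over any field is a finite system
    of polynomial equations over the integers, which specializes to an
    algebraically closed field of positive characteristic. *)

Require Import Defs.
From HB Require Import structures.
From mathcomp Require Import all_boot all_order all_algebra.
From mathcomp Require Import mpoly.
From mathcomp Require Import classical_sets reals constructive_ereal ereal.
From mathcomp Require Import boolp closed_field zify ring fraction.

Set Implicit Arguments.
Unset Strict Implicit.
Unset Printing Implicit Defensive.

Import Order.TTheory GRing.Theory Num.Theory.
Local Open Scope classical_set_scope.
Local Open Scope ring_scope.

(** * Specialization to positive characteristic *)

Lemma exists_minimal (U : Type) (P : U -> Prop) (f : U -> nat) :
  (exists x, P x) -> exists2 x, P x & forall y, P y -> (f x <= f y)%N.
Proof.
case=> x Px; elim/ltn_ind: {x}(f x) {-2}x (erefl (f x)) Px => n IH x fx Px.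
have [[y [Py lt_yx]]|H] := pselect (exists y, P y /\ (f y < n)%N).
  exact: (IH _ lt_yx y).
exists x => // y Py; rewrite fx leqNgt; apply/negP => lt_yx; apply: H.
by exists y.
Qed.

(** A Nullstellensatz-type property of the ring v(T): its maps to algebraically closed fields of
    positive characteristic detect each nonzero element. Phrased through the kernel of [v], it
    allows [T] to be an iterated polynomial ring over the integers. *)
Definition specializable (T : idomainType) (K : fieldType)
    (v : {rmorphism T -> K}) : Prop :=
  forall e, v e != 0 ->
  exists (p : nat) (L : closedFieldType) (w : {rmorphism T -> L}),
    [/\ p \in [pchar L], forall x, v x = 0 -> w x = 0 & w e != 0].

(** Reduction modulo p works for p the characteristic of [K] if that is positive, and otherwise for
    a prime exceeding the absolute value of [e]. *)
Lemma specializable_int (K : fieldType) :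
  specializable (intr : {rmorphism int -> K}).
Proof.
move=> e /= e_neq0.
suff [p p_pr [kerP eP]] : exists2 p, prime p &
    (forall x : int, x%:~R = 0 :> K -> (p %| absz x)%N) /\ ~~ (p %| absz e)%N.
  have [L [f _]] := countable_algebraic_closure 'F_p.
  have pL : p \in [pchar L].
    by rewrite (fmorph_pchar f) pchar_Fp.
  have intL (x : int) : (x%:~R == 0 :> L) = (p %| absz x)%N.
    rewrite (dvdn_pcharf pL).
    by case: x => n //; rewrite NegzE rmorphN oppr_eq0.
  exists p, L, (intr : {rmorphism int -> L}); split => //=.
    by move=> x /kerP; rewrite -intL => /eqP.
  by rewrite intL.
have intK (x : int) : (x%:~R == 0 :> K) = ((absz x)%:R == 0 :> K).
  by case: x => n //; rewrite NegzE rmorphN oppr_eq0.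
have [[p pK]|K0] := pselect (exists p, p \in [pchar K]).
  exists p; first exact: pcharf_prime pK.
  split=> [x /eqP|]; first by rewrite intK (dvdn_pcharf pK).
  by rewrite (dvdn_pcharf pK) -intK.
have {}K0 n : (n%:R == 0 :> K) = (n == 0)%N.
  apply: (pcharf0P K).1 => p; apply/negP => pK; by apply: K0; exists p.
have [p lt_ep p_pr] := prime_above (absz e).
exists p => //; split=> [x /eqP|]; first by rewrite intK K0 => /eqP->.
have e_gt0 : (0 < `|e|)%N by rewrite lt0n -K0 -intK.
by apply/negP => /dvdn_leq; rewrite e_gt0 leqNgt lt_ep => /(_ isT).
Qed.

(** Replaces a polynomial with nonzero image by one with the same image whose leading coefficient is
    not sent to 0, as pseudo-division requires. *)
Lemma exists_trunc_poly (T : idomainType) (K : fieldType)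
    (v : {rmorphism T -> K}) (g : {poly T}) :
  exists2 h : {poly T}, map_poly v h = map_poly v g &
    size h = size (map_poly v g).
Proof.
pose h := \poly_(i < size (map_poly v g)) g`_i.
have vh : map_poly v h = map_poly v g.
  apply/polyP => i; rewrite !coef_map coef_poly /=.
  case: ltnP => // le_i; rewrite rmorph0 -coef_map /=.
  by rewrite nth_default.
exists h => //; apply/eqP; rewrite eqn_leq size_poly -{1}vh size_poly //.
Qed.

(* If c is algebraic over the image of v, take q in T[X] of least degree with
   q(c) = 0, and a constant b that agrees with a multiple of e at c; then a root
   of the image of q works as soon as lead_coef q * b is not sent to 0. *)
Lemma specializable_poly (T : idomainType) (K : fieldType)
    (v : {rmorphism T -> K}) (c : K) :
  specializable v ->
  exists w : {rmorphism {poly T} -> K},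
    [/\ forall a, w a%:P = v a, w 'X = c & specializable w].
Proof.
move=> spv.
have cv (S : fieldType) (f : {rmorphism T -> S}) (y : S) : commr_rmorph f y.
  by move=> a; apply: mulrC.
pose w : {rmorphism {poly T} -> K} := horner_morph (cv _ v c).
have wE g : w g = (map_poly v g).[c] by [].
exists w; split=> [a||e we].
- by rewrite wE map_polyC hornerC.
- by rewrite wE map_polyX hornerX.
have [[q [qv wq]]|tr] :=
  pselect (exists q, map_poly v q != 0 /\ w q = 0); last first.
  (* Here c is transcendental over the image of [v]: the kernel of [w] consists of the polynomials
     with coefficients in the kernel of [v], so any non-root of the specialized [e] can be the image
     of ['X]. *)
  have {}tr q : w q = 0 -> map_poly v q = 0.
    move=> wq; apply/eqP; apply: contrapT => /negP qv.
    by apply: tr; exists q.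
  have ev : lead_coef (map_poly v e) != 0.
    by rewrite lead_coef_eq0; apply: contraNneq we => e0; rewrite wE e0 horner0.
  rewrite /lead_coef coef_map /= in ev.
  have [p [L [v' [pL ker' ev']]]] := spv _ ev.
  have /closed_nonrootP[d rd] : map_poly v' e != 0.
    by apply: contraNneq ev' => /polyP/(_ (size (map_poly v e)).-1);
       rewrite coef_map /= => ->; rewrite coef0.
  exists p, L, (horner_morph (cv _ v' d)); split=> // g /tr gv.
  rewrite /= /horner_morph; suff -> : map_poly v' g = 0 by rewrite horner0.
  apply/polyP => i; rewrite coef_map coef0 /=; apply: ker'.
  by rewrite -coef_map /= gv coef0.
have [q0 [q0v wq0] minq0] := exists_minimal (fun g => size (map_poly v g))
  (ex_intro (fun q => map_poly v q != 0 /\ w q = 0) q (conj qv wq)).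
have {qv wq} [{}q qv size_q] := exists_trunc_poly v q0.
rewrite -qv in q0v size_q minq0; have {wq0} wq : w q = 0 by rewrite wE qv.
have ltq g : w g = 0 -> (size (map_poly v g) < size q)%N -> map_poly v g = 0.
  move=> wg; rewrite size_q ltnNge => ge; apply/eqP; apply: contraNT ge => gv.
  exact: (minq0 g (conj gv wg)).
have lead0 (g : {poly T}) : g != 0 -> size g = size (map_poly v g) -> v (lead_coef g) != 0.
  move=> g0 size_g; rewrite /lead_coef -(coef_map v) /= size_g.
  by rewrite lead_coef_eq0 -size_poly_eq0 -size_g size_poly_eq0.
have q_neq0 : q != 0 by apply: contraNneq q0v => ->; rewrite map_poly0.
have lq := lead0 q q_neq0 size_q.
have size_map (g : {poly T}) : (size (map_poly v g) <= size g)%N by exact: size_poly.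
have wmap (f g : {poly T}) : map_poly v f = map_poly v g -> w f = w g.
  by rewrite !wE => ->.
(* Among the polynomials that are nonzero at c and agree there with a multiple of [e], one of least
   degree will turn out to be the constant b. *)
pose P r := w r != 0 /\ exists u, w r = w (u * e).
have Pe : P e by split=> //; exists 1; rewrite mul1r.
have [r0 [wr0 [u ru0]] minr0] :=
  exists_minimal (fun g => size (map_poly v g)) (ex_intro P e Pe).
have [r rv size_r] := exists_trunc_poly v r0.
have wr := wmap _ _ rv; rewrite -rv in size_r minr0.
rewrite -wr in wr0 ru0.
have minr g : P g -> (size r <= size g)%N.
  by move=> /minr0; rewrite -size_r => /leq_trans; apply; apply: size_map.
have r_neq0 : r != 0 by apply: contraNneq wr0 => ->; rewrite rmorph0.
have lr := lead0 r r_neq0 size_r.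
have wZ (a : T) k (g : {poly T}) : w (a ^+ k *: g) = v a ^+ k * w g.
  by rewrite -mul_polyC wE rmorphM /= map_polyC hornerM hornerC -wE -rmorphXn.
have lt_rq : (size r < size q)%N.
  apply: (@leq_ltn_trans (size (r %% q)%R)); last by rewrite ltn_modp.
  apply: minr; rewrite /P.
  have -> : r %% q = lead_coef q ^+ scalp r q *: r - r %/ q * q.
    by rewrite Pdiv.Idomain.divp_eq addrC addKr.
  rewrite rmorphB rmorphM wq mulr0 subr0 wZ; split.
    by rewrite mulf_neq0 // expf_neq0.
  exists (lead_coef q ^+ scalp r q *: u).
  by rewrite -scalerAl wZ ru0.
(* Pseudo-divide q by r. The remainder vanishes at c by minimality of r, and then has image 0 by
   minimality of q. So the quotient vanishes at c as well; if r is not constant, its image is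
   shorter than q, against minimality of q. *)
have r1 : size r = 1%N.
  apply/eqP; rewrite eqn_leq size_poly_gt0 r_neq0 andbT leqNgt.
  apply/negP => r_gt1; set h := q %/ r; set r2 := q %% r.
  have qE := Pdiv.Idomain.divp_eq q r; rewrite -/h -/r2 in qE.
  have lt_r2 : (size r2 < size r)%N by rewrite ltn_modp.
  have r2E : r2 = lead_coef r ^+ scalp q r *: q - h * r.
    by rewrite qE addrC addKr.
  have wr2 : w r2 = - w h * w r.
    by rewrite r2E rmorphB wZ wq mulr0 sub0r rmorphM mulNr.
  have wr2_0 : w r2 = 0.
    apply/eqP; apply: contraTT lt_r2 => wr2_0; rewrite -leqNgt; apply: minr.
    split=> //; exists (- h * u).
    by rewrite wr2 ru0 -mulrA [in RHS]rmorphM rmorphN.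
  have wh : w h = 0.
    move/eqP: wr2; rewrite wr2_0 eq_sym mulf_eq0 (negPf wr0) orbF oppr_eq0.
    by move/eqP.
  have r2v : map_poly v r2 = 0.
    apply: ltq => //; apply: leq_ltn_trans (size_map _) _.
    exact: ltn_trans lt_r2 lt_rq.
  have qv' : v (lead_coef r) ^+ scalp q r *: map_poly v q
             = map_poly v h * map_poly v r.
    move/(congr1 (map_poly v)): qE.
    by rewrite rmorphD rmorphM /= r2v addr0 map_polyZ /= rmorphXn.
  have lr' : v (lead_coef r) ^+ scalp q r != 0 by rewrite expf_neq0.
  have hr_neq0 : map_poly v h * map_poly v r != 0.
    by rewrite -qv' scaler_eq0 negb_or lr'.
  have := hr_neq0; rewrite mulf_eq0 negb_or => /andP[hv_neq0 rv_neq0].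
  case/negP: (hv_neq0); apply/eqP/ltq => //.
  have : size (map_poly v q) = (size (map_poly v h) + size (map_poly v r)).-1.
    by rewrite -(size_scale (map_poly v q) lr') qv' size_mul.
  rewrite -size_q -size_r => ->; move: r_gt1.
  by case: (size r) => [|[|k]] // _; rewrite !addnS /= ltnS leq_addr.
have [b b0 rE] : exists2 b, b != 0 & r = b%:P by apply/size_poly1P; rewrite r1.
have wb : v b != 0 by move: wr0; rewrite rE wE map_polyC hornerC.
have [|p [L [v' [pL ker']]]] := spv (lead_coef q * b).
  by rewrite rmorphM mulf_neq0.
rewrite rmorphM mulf_eq0 negb_or => /andP[lq' b'].
have size_q' : size (map_poly v' q) = size q by rewrite size_map_poly_id0.
have kerP (g : {poly T}) : map_poly v g = 0 -> map_poly v' g = 0.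
  move=> gv; apply/polyP => i; rewrite coef_map coef0 /=; apply: ker'.
  by rewrite -coef_map /= gv coef0.
have /closed_rootP[d /rootP rd] : size (map_poly v' q) != 1%N.
  by rewrite size_q' neq_ltn -r1 lt_rq orbT.
pose w' : {rmorphism {poly T} -> L} := horner_morph (cv _ v' d).
have w'E g : w' g = (map_poly v' g).[d] by [].
(* The pseudo-remainder of g by q vanishes at c and is shorter than q, so its coefficients lie in
   the kernel of [v], hence of [v']; and d is a root of the specialized q. *)
have kerw g : w g = 0 -> w' g = 0.
  move=> wg; have gE := Pdiv.Idomain.divp_eq g q.
  have gq : map_poly v (g %% q) = 0.
    apply: ltq; last by apply: leq_ltn_trans (size_map _) _; rewrite ltn_modp.
    have -> : g %% q = lead_coef q ^+ scalp g q *: g - g %/ q * q.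
      by rewrite gE addrC addKr.
    by rewrite rmorphB rmorphM wq mulr0 subr0 wZ wg mulr0.
  move/(congr1 w'): gE; rewrite rmorphD rmorphM /= !w'E rd mulr0 add0r.
  rewrite (kerP _ gq) horner0 map_polyZ hornerZ rmorphXn => /eqP.
  by rewrite mulf_eq0 expf_eq0 (negPf lq') andbF => /eqP.
exists p, L, w'; split=> //; apply: contraNneq b' => w'e.
have : w' (r - u * e) = 0 by apply: kerw; rewrite rmorphB ru0 subrr.
by rewrite rmorphB rmorphM w'e mulr0 subr0 rE w'E map_polyC hornerC => /eqP.
Qed.

(** [T] is a polynomial ring over the integers with one variable for each entry of [s]. *)
Lemma exists_specializable (K : fieldType) (s : seq K) :
  exists (T : idomainType) (v : {rmorphism T -> K}),
    specializable v /\ forall x, x \in s -> exists a, v a = x.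
Proof.
elim: s => [|c s [T [v [spv liftv]]]].
  by exists int, (intr : {rmorphism int -> K}); split=> //; exact: specializable_int.
have [w [wC wX spw]] := specializable_poly c spv.
exists {poly T}, w; split=> // x; rewrite inE => /predU1P[->|/liftv[a <-]].
  by exists 'X.
by exists a%:P.
Qed.
(** * Integral elements over powers of an ideal *)

Lemma mcoeffMX_if (n : nat) (R : comNzRingType) (a : {mpoly R[n]})
    (mu nu : 'X_{1..n}) :
  (a * 'X_[nu])@_mu = if (nu <= mu)%MM then a@_(mu - nu)%MM else 0.
Proof.
case: ifP => [/submK {1}<-|Nle]; first by rewrite addmC mcoeffMX.
apply: memN_msupp_eq0; rewrite (perm_mem (msuppMX _ _)).
by apply/negP => /mapP[k _ E]; rewrite E lem_addr in Nle.
Qed.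

(** Every element has a q-th root, unique because q is a power of the characteristic; hence taking
    roots is additive and multiplicative. *)
Lemma exists_qroot (L : closedFieldType) (p e : nat) (q := (p ^ e)%N) :
  p \in [pchar L] ->
  exists r : L -> L, [/\ forall x y, r (x + y) = r x + r y,
    forall x y, r (x * y ^+ q) = r x * y & forall x, (r x == 0) = (x == 0)].
Proof.
move=> pL; have q_gt0 : (0 < q)%N by rewrite expn_gt0 prime_gt0 ?(pcharf_prime pL).
have pq : [pchar L].-nat q by rewrite pnatX (pnatE _ (pcharf_prime pL)) pL.
have surj x : exists y : L, y ^+ q == x.
  have /closed_rootP[y] : size ('X^q - x%:P) != 1%N :> nat.
    by rewrite size_XnsubC // -lt0n.
  by rewrite /root !hornerE subr_eq0; exists y.
have inj (x y : L) : x ^+ q = y ^+ q -> x = y.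
  move=> xy; apply/eqP; rewrite -subr_eq0.
  suff /eqP : (x - y) ^+ q = 0 by rewrite expf_eq0 => /andP[].
  by apply: (addIr (y ^+ q)); rewrite add0r -exprDn_pchar // subrK.
pose r x := xchoose (surj x).
have rq x : r x ^+ q = x by exact/eqP/(xchooseP (surj x)).
exists r; split=> [x y|x y|x]; last 1 first.
- by rewrite -{2}(rq x) expf_eq0 q_gt0.
- by apply: inj; rewrite exprDn_pchar // !rq.
- by apply: inj; rewrite exprMn !rq.
Qed.

(* The coefficient of f x at m is the q-th root of that of x at b + q m. *)
Lemma exists_frobenius_splitting (L : closedFieldType) (n p e : nat)
    (q := (p ^ e)%N) (b : 'X_{1..n}) :
  p \in [pchar L] -> (forall i, b i < q)%N ->
  exists f : {mpoly L[n]} -> {mpoly L[n]},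
    [/\ forall x y, f (x + y) = f x + f y,
        forall x y, f (x * y ^+ q) = f x * y &
        forall x m, ((f x)@_m == 0) = (x@_(b + m *+ q)%MM == 0)].
Proof.
move=> pL bq; have p_pr := pcharf_prime pL.
have q_gt0 : (0 < q)%N by rewrite expn_gt0 prime_gt0.
have pR : p \in [pchar {mpoly L[n]}] by apply: (rmorph_pchar (@mpolyC n L)).
have qR : [pchar {mpoly L[n]}].-nat q by rewrite pnatX pnatE // pR.
have [r [rD rM r_eq0]] := exists_qroot e pL; rewrite -/q in rM.
have r0 : r 0 = 0 by apply/eqP; rewrite r_eq0.
pose f (x : {mpoly L[n]}) : {mpoly L[n]} :=
  \sum_(m : 'X_{1..n < msize x}) r x@_(b + m *+ q)%MM *: 'X_[m].
have fE x m : (f x)@_m = r x@_(b + m *+ q)%MM.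
  have [lt_m|le_m] := ltnP (mdeg m) (msize x).
    by rewrite (mcoeff_mpoly (fun m => r x@_(b + m *+ q)%MM)).
  rewrite memN_msupp_eq0; last first.
    apply/negP => /msupp_sum_le /flattenP[s /mapP[k _ ->]].
    move=> /msuppZ_le /mem_msuppXP km; move: le_m; rewrite -km leqNgt.
    by rewrite bmdeg.
  rewrite memN_msupp_eq0 ?r0 //; apply: msize_mdeg_ge; apply: leq_trans le_m _.
  by rewrite mdegD mdegMn (leq_trans _ (leq_addl _ _)) // leq_pmulr.
have fD x y : f (x + y) = f x + f y.
  by apply/mpolyP => m; rewrite mcoeffD !fE mcoeffD rD.
exists f; split=> // [x y|x m]; last by rewrite fE r_eq0.
elim/mpolyind: y => [|c m y _ _ IH].
  rewrite expr0n gtn_eqF // !mulr0; apply/mpolyP => m.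
  by rewrite fE !mcoeff0 r0.
rewrite exprDn_pchar // !mulrDr fD {}IH; congr (_ + _).
apply/mpolyP => k; rewrite fE.
rewrite exprZn mpolyXn -!scalerAr !mcoeffZ !mcoeffMX_if.
(* The exponents of [b] are less than q, so adding [b] does not affect divisibility by the q-th
   power of a monomial. *)
have -> : (m *+ q <= b + k *+ q)%MM = (m <= k)%MM.
  apply/mnm_lepP/mnm_lepP => le_mk i; move: (le_mk i);
    rewrite !(mnmDE, mulmnE) => {}le_mk; last first.
    by apply: leq_trans (leq_addl _ _); rewrite leq_mul2r le_mk orbT.
  have := bq i; move: le_mk q_gt0; nia.
case: ifP => [/mnm_lepP le_mk|_]; last by rewrite !mulr0 r0.
rewrite fE [X in r X]mulrC rM mulrC; congr (_ * r _@__).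
apply/mnmP => i; rewrite !(mnmBE, mnmDE, mulmnE).
by rewrite mulnBl addnBA // leq_mul2r le_mk orbT.
Qed.

(** * Degrees and orders of polynomials *)

Definition degree_le (n : nat) (R : nzRingType) (d : nat) (p : {mpoly R[n]}) :=
  forall m, m \in msupp p -> (mdeg m <= d)%N.

(** Evaluated at generators of an ideal, the polynomials of order at least d give its d-th power. *)
Definition order_ge (n : nat) (R : nzRingType) (d : nat) (p : {mpoly R[n]}) :=
  forall m, m \in msupp p -> (d <= mdeg m)%N.

(** Counts the outer variables, which stand for generators, together with the degree of the
    coefficients: a bound leaves finitely many scalars, so that linear algebra applies. *)
Definition total_degree_le (l n : nat) (R : nzRingType) (d : nat)
    (p : {mpoly {mpoly R[n]}[l]}) :=
  forall a b, b \in msupp p@_a -> (mdeg a + mdeg b <= d)%N.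

Section DegreeBounds.
Variables (n : nat) (R : nzRingType).
Implicit Types p q : {mpoly R[n]}.

Lemma degree_leM d e p q :
  degree_le d p -> degree_le e q -> degree_le (d + e) (p * q).
Proof.
move=> dp eq m /msuppM_le /allpairsP[[a b] /= [/dp da /eq eb ->]].
by rewrite mdegD leq_add.
Qed.

Lemma degree_le1 : degree_le 0 (1 : {mpoly R[n]}).
Proof. by move=> m; rewrite msupp1 inE => /eqP->; rewrite mdeg0. Qed.

Lemma degree_leX d p k : degree_le d p -> degree_le (d * k) (p ^+ k).
Proof.
move=> dp; elim: k => [|k IH]; first by rewrite muln0; apply: degree_le1.
by rewrite exprS mulnS; apply: degree_leM.
Qed.

Lemma degree_le_prod (I : finType) (F : I -> {mpoly R[n]}) (d : I -> nat) :
  (forall i, degree_le (d i) (F i)) -> degree_le (\sum_i d i) (\prod_i F i).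
Proof.
move=> dF; elim/big_rec2: _ => [|i e p _ IH]; first exact: degree_le1.
exact: degree_leM.
Qed.

Lemma degree_le_trans d e p : degree_le d p -> (d <= e)%N -> degree_le e p.
Proof. by move=> dp de m /dp; move/leq_trans; apply. Qed.

Lemma degree_le_msize p : degree_le (msize p) p.
Proof. by move=> m /msize_mdeg_lt/ltnW. Qed.

Lemma order_geM d e p q :
  order_ge d p -> order_ge e q -> order_ge (d + e) (p * q).
Proof.
move=> dp eq m /msuppM_le /allpairsP[[a b] /= [/dp da /eq eb ->]].
by rewrite mdegD leq_add.
Qed.

Lemma order_geX d p k : order_ge d p -> order_ge (d * k) (p ^+ k).
Proof.
move=> dp; elim: k => [|k IH]; first by rewrite muln0.
by rewrite exprS mulnS; apply: order_geM.
Qed.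

Lemma order_geZ d c p : order_ge d p -> order_ge d (c *: p).
Proof. by move=> dp m /msuppZ_le/dp. Qed.

Lemma order_ge_sum (I : Type) (r : seq I) (P : pred I)
    (F : I -> {mpoly R[n]}) d :
  (forall i, P i -> order_ge d (F i)) -> order_ge d (\sum_(i <- r | P i) F i).
Proof.
move=> dF; elim/big_rec: _ => [|i p Pi IH] m; first by rewrite msupp0.
by move/msuppD_le; rewrite mem_cat => /orP[/dF|/IH] //; apply.
Qed.

Lemma order_ge_mpolyX d m : (d <= mdeg m)%N -> order_ge d ('X_[m] : {mpoly R[n]}).
Proof. by move=> dm k /mem_msuppXP <-. Qed.

End DegreeBounds.

Section TotalDegreeBounds.
Variables (l n : nat) (R : nzRingType).
Implicit Types p q : {mpoly {mpoly R[n]}[l]}.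

Lemma msupp_sum_exists (I : Type) (r : seq I) (P : pred I)
    (F : I -> {mpoly R[n]}) m :
  m \in msupp (\sum_(i <- r | P i) F i) -> exists2 i, P i & m \in msupp (F i).
Proof.
elim/big_rec: _ => [|i p Pi IH]; first by rewrite msupp0.
by move/msuppD_le; rewrite mem_cat => /orP[mi|/IH//]; exists i.
Qed.

Lemma total_degree_leM d e p q :
  total_degree_le d p -> total_degree_le e q -> total_degree_le (d + e) (p * q).
Proof.
move=> dp eq a b; rewrite mcoeffM => /msupp_sum_exists[[a1 a2] /= /eqP aE].
move=> /msuppM_le /allpairsP[[b1 b2] /= [/dp da /eq eb ->]].
by rewrite [in mdeg a]aE !mdegD addnACA leq_add.
Qed.

Lemma total_degree_leC d (p : {mpoly R[n]}) :
  degree_le d p -> total_degree_le d (p%:MP : {mpoly {mpoly R[n]}[l]}).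
Proof.
move=> dp a b; rewrite mcoeffC; case: eqP => [->|_].
  by rewrite mulr1 mdeg0 => /dp.
by rewrite mulr0 msupp0.
Qed.

Lemma total_degree_leX d p k :
  total_degree_le d p -> total_degree_le (d * k) (p ^+ k).
Proof.
move=> dp; elim: k => [|k IH]; last by rewrite exprS mulnS; apply: total_degree_leM.
by rewrite muln0 expr0 -mpolyC1; apply: total_degree_leC; apply: degree_le1.
Qed.

Lemma total_degree_le_mpolyX m :
  total_degree_le (mdeg m) ('X_[m] : {mpoly {mpoly R[n]}[l]}).
Proof.
move=> a b; rewrite mcoeffX; case: eqP => [<-|_]; last by rewrite msupp0.
by rewrite msupp1 inE => /eqP->; rewrite mdeg0 addn0.
Qed.

Lemma exists_total_degree_le p : exists d, total_degree_le d p.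
Proof.
exists (msize p + \max_(a <- msupp p) msize p@_a)%N => a b bpa.
have ap : a \in msupp p.
  by rewrite mcoeff_msupp; apply: contraTneq bpa => ->; rewrite msupp0.
apply: leq_add; first exact/ltnW/msize_mdeg_lt.
apply: leq_trans (ltnW (msize_mdeg_lt bpa)) _.
by apply: (leq_bigmax_seq (F := fun a => msize p@_a)).
Qed.

End TotalDegreeBounds.

(* With c = (g i0)^(N k), the element c f^q is a polynomial in g of order at
   least N q, with coefficients of degree at most q times a constant. Each
   monomial of that order is the q-th power of a monomial of order at least
   N - l times a remainder. *)
Lemma pow_mem_order_ge_pchar (L : closedFieldType) (p n l N k D E : nat)
    (g : 'I_l -> {mpoly L[n]}) (i0 : 'I_l) (f : {mpoly L[n]})
    (A : {mpoly {mpoly L[n]}[l]}) :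
  p \in [pchar L] -> g i0 != 0 -> (0 < k)%N -> f ^+ k = A.@[g] ->
  order_ge (N * k) A -> total_degree_le E A ->
  (forall i, degree_le D (g i)) -> degree_le D f ->
  exists C : {mpoly {mpoly L[n]}[l]},
    [/\ f = C.@[g], order_ge (N - l) C & total_degree_le (E + l * D + 1) C].
Proof.
move=> pL g0 k_gt0 fk ordA degA degg degf.
have p_gt1 : (1 < p)%N := prime_gt1 (pcharf_prime pL).
(* As q > e, q exceeds the degree of c, and D k + N k is at most q, which accounts for the summand 1
   in the final degree bound. *)
pose e := (k * D + N * k * D + N * k)%N; pose q := (p ^ e)%N.
have lt_eq : (e < q)%N by rewrite ltn_expl.
have q_gt0 : (0 < q)%N by apply: leq_ltn_trans lt_eq.
pose c := g i0 ^+ (N * k); have c0 : c != 0 by rewrite expf_neq0.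
pose b := mlead c; have bc : b \in msupp c by apply: mlead_supp.
have degc : degree_le (D * (N * k)) c by apply: degree_leX.
have bq i : (b i < q)%N.
  apply: leq_ltn_trans (_ : mdeg b < q)%N.
    by rewrite mdegE (bigD1 i) //= leq_addr.
  by apply: leq_ltn_trans (leq_trans (degc _ bc) _) lt_eq; rewrite /e; lia.
have [s [sD sM s_eq0]] := exists_frobenius_splitting pL bq.
rewrite -/q in sM s_eq0.
have s0 : s 0 = 0 by apply: (addrI (s 0)); rewrite -sD !addr0.
have s_sum (I : Type) (r : seq I) (F : I -> {mpoly L[n]}) :
    s (\sum_(i <- r) F i) = \sum_(i <- r) s (F i).
  by elim: r => [|i r IH]; rewrite ?big_nil // !big_cons sD IH.
(* Only the full k-th powers in f^q are replaced by A; the order thus lost is at most N k, and the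
   last factor, whose value is c, restores it. *)
pose B := A ^+ (q %/ k) * (f ^+ (q %% k))%:MP * 'X_i0 ^+ (N * k).
have Bg : B.@[g] = c * f ^+ q.
  rewrite !rmorphM /= !rmorphXn /= mevalC mevalXU -fk -exprM -exprD.
  by rewrite [X in f ^+ (X + _)]mulnC -divn_eq mulrC.
have ordB : order_ge (N * q) B.
  move=> a /msuppM_le /allpairsP[[a1 a2] /= [a1B a2B ->]].
  move: a2B; rewrite mpolyXn => /mem_msuppXP <-.
  move: a1B => /msuppM_le /allpairsP[[a3 a4] /= [a3B a4B ->]].
  have := order_geX ordA a3B.
  rewrite !mdegD mdegMn mdeg1 mul1n.
  have := ltn_ceil q k_gt0; nia.
have degB : total_degree_le (E * (q %/ k) + D * (q %% k) + N * k) B.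
  apply: total_degree_leM; first apply: total_degree_leM.
  - exact: total_degree_leX.
  - exact/total_degree_leC/degree_leX.
  - rewrite mpolyXn -[X in total_degree_le X](_ : mdeg (U_(i0) *+ (N * k))%MM = _).
      exact: total_degree_le_mpolyX.
    by rewrite mdegMn mdeg1 mul1n.
pose quo (a : 'X_{1..l}) := [multinom (a i %/ q)%N | i < l].
pose rem (a : 'X_{1..l}) := [multinom (a i %% q)%N | i < l].
have aE (a : 'X_{1..l}) : a = (quo a *+ q + rem a)%MM.
  by apply/mnmP => i; rewrite mnmDE mulmnE !mnmE -divn_eq.
have deg_rem a : (mdeg (rem a) <= l * q)%N.
  rewrite mdegE -[X in (_ <= X * _)%N]card_ord -sum_nat_const.
  by apply: leq_sum => i _; rewrite mnmE ltnW // ltn_mod.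
pose G a := \prod_i g i ^+ (rem a) i.
have degG a : degree_le (D * (l * q)) (G a).
  apply: (@degree_le_trans _ _ (\sum_i D * rem a i)).
    by apply: degree_le_prod => i; apply: degree_leX.
  by rewrite -big_distrr -mdegE leq_mul2l deg_rem orbT.
pose C0 : {mpoly {mpoly L[n]}[l]} :=
  \sum_(a <- msupp B) s (B@_a * G a) *: 'X_[quo a].
(* A coefficient of [s c] at m <> 0 would come from one of c in degree at least q, beyond the degree
   of c. The constant coefficient comes from the leading one of c, so it is not 0. *)
have sc : s c = ((s c)@_0)%:MP.
  apply/mpolyP => m; rewrite mcoeffC; have [->|m0] := eqVneq m 0%MM.
    by rewrite mulr1.
  rewrite mulr0; apply/eqP; rewrite s_eq0 mcoeff_eq0; apply/negP => /degc.
  rewrite mdegD mdegMn; have : (0 < mdeg m)%N by rewrite lt0n mdeg_eq0.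
  nia.
have kappa0 : (s c)@_0 != 0.
  rewrite s_eq0 (_ : (b + 0 *+ q)%MM = b) -?mcoeff_msupp //.
  by apply/mnmP => i; rewrite mnmDE mulmnE mnm0E mul0n addn0.
set kappa := (s c)@_0 in sc kappa0.
have fC0 : kappa%:MP * f = C0.@[g].
  rewrite -sc -sM -Bg mevalE s_sum rmorph_sum /=; apply: eq_bigr => a _.
  rewrite mevalZ mevalX -sM; congr (s _); rewrite -mulrA; congr (_ * _).
  rewrite mulrC -prodrXl -big_split /=; apply: eq_bigr => i _.
  by rewrite -exprM -exprD {1}(aE a) mnmDE mulmnE.
exists ((kappa^-1)%:MP *: C0); split.
- by rewrite mevalZ -fC0 mulrA -mpolyCM mulVf // mpolyC1 mul1r.
- apply: order_geZ; rewrite /C0 big_seq; apply: order_ge_sum => a /ordB ord_a.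
  apply/order_geZ/order_ge_mpolyX.
  rewrite leq_subLR -(leq_pmul2r q_gt0) (leq_trans ord_a) //.
  by rewrite {1}(aE a) mdegD mdegMn mulnDl addnC leq_add2r deg_rem.
- move=> a' b'; rewrite mcoeffZ mul_mpolyC => /msuppZ_le.
  rewrite raddf_sum /= => /msupp_sum_exists[a _].
  rewrite mcoeffZ mcoeffX; case: eqP => [<-|_]; last first.
    by rewrite mulr0 msupp0.
  rewrite mulr1 mcoeff_msupp s_eq0 -mcoeff_msupp.
  move=> /msuppM_le /allpairsP[[b1 b2] /= [/degB deg1 /degG deg2]].
  (* A monomial b' of the value of [s] comes from the monomial b + q b' of its argument, so degrees
     are divided by q and the bound becomes independent of q. *)
  move/(congr1 (@mdeg n)); rewrite !mdegD mdegMn => bE.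
  rewrite -(leq_pmul2r q_gt0).
  have degq : (mdeg (quo a) * q <= mdeg a)%N.
    by rewrite [X in (_ <= mdeg X)%N](aE a) mdegD mdegMn leq_addr.
  have Eq : (E * (q %/ k) <= E * q)%N by rewrite leq_mul2l leq_div orbT.
  have Dq : (D * (q %% k) <= D * k)%N.
    by rewrite leq_mul2l (ltnW (ltn_pmod _ _)) ?orbT.
  have Dk : (D * k + N * k <= q)%N by apply: leq_trans (ltnW lt_eq); rewrite /e; lia.
  lia.
Qed.

(** * Linear functionals and lifting of coefficients *)

Lemma span_or_separate (K : fieldType) (I J : finType) (u : I -> J -> K)
    (f : J -> K) :
  (exists y : I -> K, forall j, f j = \sum_i y i * u i j) \/
  (exists w : J -> K, (forall i, \sum_j u i j * w j = 0) /\
                      \sum_j f j * w j != 0).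
Proof.
pose U := \matrix_(i < #|I|, j < #|J|) u (enum_val i) (enum_val j).
pose F := \row_(j < #|J|) f (enum_val j).
have sumJ (a b : J -> K) :
    \sum_j a j * b j = \sum_(j < #|J|) a (enum_val j) * b (enum_val j).
  by rewrite [LHS](reindex _ (onW_bij _ (@enum_val_bij J))).
have sumI (a b : I -> K) :
    \sum_j a j * b j = \sum_(j < #|I|) a (enum_val j) * b (enum_val j).
  by rewrite [LHS](reindex _ (onW_bij _ (@enum_val_bij I))).
have [/submxP[Y FY]|] := boolP (F <= U)%MS.
  left; exists (fun i => Y 0 (enum_rank i)) => j.
  have /matrixP/(_ 0 (enum_rank j)) := FY; rewrite !mxE enum_rankK => ->.
  apply: esym; apply: etrans (sumI _ _) _; apply: eq_bigr => i _.
  by rewrite enum_valK !mxE enum_rankK.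
rewrite submxE => /rV0Pn[k Fk]; right.
exists (fun j => cokermx U (enum_rank j) k); split => [i|].
  have /matrixP/(_ (enum_rank i) k) := mulmx_coker U; rewrite [in RHS]mxE; apply: etrans.
  apply: etrans (sumJ (u i) _) _; rewrite mxE; apply: eq_bigr => j _.
  by rewrite [in RHS]mxE enum_valK enum_rankK.
move: Fk; congr (_ != _); apply: esym.
apply: etrans (sumJ f _) _.
by rewrite mxE; apply: eq_bigr => j _; rewrite [in RHS]mxE enum_valK.
Qed.

Lemma mcoeff_sum_msupp (n : nat) (R S : nzRingType) (p : {mpoly S[n]})
    (E : 'X_{1..n} -> R) (m : 'X_{1..n}) :
  (\sum_(a <- msupp p) E a *: 'X_[a])@_m = if m \in msupp p then E m else 0.
Proof.
rewrite raddf_sum /=; case: ifPn => [mp|Nmp].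
  rewrite (bigD1_seq m) ?msupp_uniq //= mcoeffZ mcoeffX eqxx mulr1 big1 ?addr0 //.
  by move=> a /negPf am; rewrite mcoeffZ mcoeffX am mulr0.
rewrite big_seq big1 // => a ap; rewrite mcoeffZ mcoeffX.
by case: eqP ap Nmp => [->->|_] //; rewrite mulr0.
Qed.

Lemma map_meval (l : nat) (R S : comNzRingType) (f : {rmorphism R -> S})
    (g : 'I_l -> R) (A : {mpoly R[l]}) :
  f A.@[g] = (map_mpoly f A).@[f \o g].
Proof.
elim/mpolyind: A => [|c m A _ _ IH]; first by rewrite !rmorph0.
rewrite !rmorphD IH /=; congr (_ + _).
rewrite mevalZ rmorphM map_mpolyZ mevalZ map_mpolyX !mevalX rmorph_prod.
by congr (_ * _); apply: eq_bigr => i _; rewrite rmorphXn.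
Qed.

Lemma map_mpoly_ker (n : nat) (T R S : nzRingType) (v : {rmorphism T -> R})
    (w : {rmorphism T -> S}) (p : {mpoly T[n]}) :
  (forall x, v x = 0 -> w x = 0) -> map_mpoly v p = 0 -> map_mpoly w p = 0.
Proof.
move=> kerP vp; apply/mpolyP => m; rewrite mcoeff0 mcoeff_map_mpoly; apply: kerP.
by rewrite -(mcoeff_map_mpoly v) vp mcoeff0.
Qed.

Lemma msupp_map_mpoly_sub (n : nat) (R S : nzRingType) (f : {rmorphism R -> S})
    (p : {mpoly R[n]}) : {subset msupp (map_mpoly f p) <= msupp p}.
Proof.
move=> m; rewrite !mcoeff_msupp mcoeff_map_mpoly; apply: contraNneq => ->.
by rewrite raddf0.
Qed.

Section Lifting.
Variables (T K : nzRingType) (v : {rmorphism T -> K}) (s : seq K) (lift : K -> T).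
Hypothesis liftK : forall x, x \in s -> v (lift x) = x.

(** [lift] is a mere choice of preimages and may send 0 to a nonzero element; summing over the
    support preserves bounds on degrees. *)
Definition lift_mpoly (n : nat) (p : {mpoly K[n]}) : {mpoly T[n]} :=
  \sum_(m <- msupp p) lift p@_m *: 'X_[m].

Definition coeffs (n : nat) (p : {mpoly K[n]}) := [seq p@_m | m <- msupp p].

Lemma msupp_lift_mpoly (n : nat) (p : {mpoly K[n]}) :
  {subset msupp (lift_mpoly p) <= msupp p}.
Proof.
move=> m; rewrite mcoeff_msupp mcoeff_sum_msupp.
by case: ifP => //; rewrite eqxx.
Qed.

Lemma lift_mpolyK (n : nat) (p : {mpoly K[n]}) :
  {subset coeffs p <= s} -> map_mpoly v (lift_mpoly p) = p.
Proof.
move=> ps; apply/mpolyP => m; rewrite mcoeff_map_mpoly mcoeff_sum_msupp.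
case: ifPn => [mp|/memN_msupp_eq0->]; last by rewrite raddf0.
by apply/liftK/ps/map_f.
Qed.

Definition lift_mpoly2 (l n : nat) (A : {mpoly {mpoly K[n]}[l]}) :
    {mpoly {mpoly T[n]}[l]} :=
  \sum_(a <- msupp A) lift_mpoly A@_a *: 'X_[a].

Lemma mcoeff_lift_mpoly2 (l n : nat) (A : {mpoly {mpoly K[n]}[l]}) a :
  (lift_mpoly2 A)@_a = if a \in msupp A then lift_mpoly A@_a else 0.
Proof. exact: mcoeff_sum_msupp. Qed.

Lemma lift_mpoly2K (l n : nat) (A : {mpoly {mpoly K[n]}[l]}) :
  (forall a, a \in msupp A -> {subset coeffs A@_a <= s}) ->
  map_mpoly (map_mpoly v) (lift_mpoly2 A) = A.
Proof.
move=> As; apply/mpolyP => a; rewrite mcoeff_map_mpoly mcoeff_lift_mpoly2.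
case: ifPn => [/As/lift_mpolyK //|/memN_msupp_eq0->]; exact: raddf0.
Qed.

Lemma order_ge_lift_mpoly2 (l n d : nat) (A : {mpoly {mpoly K[n]}[l]}) :
  order_ge d A -> order_ge d (lift_mpoly2 A).
Proof.
move=> dA a; rewrite mcoeff_msupp mcoeff_lift_mpoly2.
by case: ifP => [/dA //|]; rewrite eqxx.
Qed.

Lemma total_degree_le_lift_mpoly2 (l n d : nat) (A : {mpoly {mpoly K[n]}[l]}) :
  total_degree_le d A -> total_degree_le d (lift_mpoly2 A).
Proof.
move=> dA a b; rewrite mcoeff_lift_mpoly2; case: ifP => _; last by rewrite msupp0.
by move/msupp_lift_mpoly/dA.
Qed.

End Lifting.

(* If f were not of this form, a linear functional w would vanish on the
   products of monomials of bounded degree with monomials of order N - l in g,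
   but not on f; the coefficients of w, f, g and A are then specialized. *)
Lemma pow_mem_order_ge (K : fieldType) (n l N k : nat)
    (g : 'I_l -> {mpoly K[n]}) (i0 : 'I_l) (f : {mpoly K[n]})
    (A : {mpoly {mpoly K[n]}[l]}) :
  g i0 != 0 -> (0 < k)%N -> f ^+ k = A.@[g] -> order_ge (N * k) A ->
  exists2 C : {mpoly {mpoly K[n]}[l]}, f = C.@[g] & order_ge (N - l) C.
Proof.
move=> g0 k_gt0 fk ordA.
have [E degA] := exists_total_degree_le A.
pose D := (msize f + \sum_i msize (g i))%N.
have degf : degree_le D f.
  exact: degree_le_trans (@degree_le_msize _ _ f) (leq_addr _ _).
have degg i : degree_le D (g i).
  apply: (degree_le_trans (@degree_le_msize _ _ (g i))).
  by rewrite /D (bigD1 i) //= addnCA leq_addr.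
(* The degree bound of [pow_mem_order_ge_pchar], the same in every characteristic. *)
pose B := (E + l * D + 1)%N.
pose u (R : comNzRingType) (h : 'I_l -> {mpoly R[n]})
    (i : 'X_{1..l < B.+1} * 'X_{1..n < B.+1}) : {mpoly R[n]} :=
  if (N - l <= mdeg i.1)%N then 'X_[i.2] * ('X_[i.1]).@[h] else 0.
have map_u (R S : comNzRingType) (v : {rmorphism R -> S}) h i :
    map_mpoly v (u R h i) = u S (map_mpoly v \o h) i.
  rewrite /u; case: ifP => _; last by rewrite rmorph0.
  by rewrite rmorphM /= map_mpolyX map_meval map_mpolyX.
pose M := (msize f + \sum_i msize (u K g i))%N.
have [[y fE]|[w [uw fw]]] :=
  span_or_separate (fun i (j : 'X_{1..n < M}) => (u K g i)@_j) (fun j => f@_j).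
  have fu : f = \sum_i (y i)%:MP * u K g i.
    apply/mpolyP => m; rewrite raddf_sum /=.
    under eq_bigr do rewrite mcoeffCM.
    have [lt_m|le_m] := ltnP (mdeg m) M; first exact: (fE (BMultinom lt_m)).
    rewrite memN_msupp_eq0; last first.
      by apply: msize_mdeg_ge; apply: leq_trans le_m; rewrite leq_addr.
    rewrite big1 // => i _; rewrite memN_msupp_eq0 ?mulr0 //.
    apply: msize_mdeg_ge; apply: leq_trans le_m.
    by rewrite /M (bigD1 i) //= addnCA leq_addr.
  exists (\sum_(i | (N - l <= mdeg (bmnm (fst i)))%N)
            ((y i)%:MP * 'X_[i.2]) *: 'X_[i.1]).
    rewrite fu rmorph_sum /= [RHS]big_mkcond /=; apply: eq_bigr => i _.
    by rewrite /u; case: ifP => _; rewrite ?mulr0 // mevalZ mulrA.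
  by apply: order_ge_sum => i ord_i; apply/order_geZ/order_ge_mpolyX.
pose s := coeffs f ++ flatten [seq coeffs (g i) | i : 'I_l] ++
  flatten [seq coeffs A@_a | a <- msupp A] ++ [seq w j | j : 'X_{1..n < M}].
have [T [v [spv liftv]]] := exists_specializable s.
have /choice[lift liftK] : forall x, exists a, x \in s -> v a = x.
  move=> x; have [xs|_] := boolP (x \in s); last by exists 0.
  by have [a] := liftv x xs; exists a.
have sF : {subset coeffs f <= s} by move=> x; rewrite mem_cat => ->.
have sG i : {subset coeffs (g i) <= s}.
  move=> x gx; rewrite !mem_cat; apply/or3P/Or32/flattenP.
  by exists (coeffs (g i)) => //; apply/mapP; exists i; rewrite ?mem_enum.
have sA a : a \in msupp A -> {subset coeffs A@_a <= s}.
  move=> aA x ax; rewrite !mem_cat; apply/or4P/Or43/flattenP.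
  by exists (coeffs A@_a) => //; apply: map_f.
have sW j : w j \in s.
  by rewrite !mem_cat; apply/or4P/Or44/mapP; exists j; rewrite ?mem_enum.
pose F := lift_mpoly lift f; pose G i := lift_mpoly lift (g i).
pose A' := lift_mpoly2 lift A; pose W j := lift (w j).
have FK : map_mpoly v F = f by apply: lift_mpolyK sF.
have GK i : map_mpoly v (G i) = g i by apply: lift_mpolyK (sG i).
have AK : map_mpoly (map_mpoly v) A' = A by apply: lift_mpoly2K sA.
have WK j : v (W j) = w j by apply: liftK.
have WE (R : comNzRingType) (x : {rmorphism T -> R}) (H : {mpoly T[n]}) :
    x (\sum_j H@_(bmnm j) * W j) = \sum_j (map_mpoly x H)@_(bmnm j) * x (W j).
  rewrite rmorph_sum; apply: eq_bigr => j _.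
  by rewrite rmorphM /= mcoeff_map_mpoly.
(* If z is not killed, then after specialization the functional is still nonzero at f, and g i0 is
   still nonzero. *)
pose z := (\sum_j F@_(bmnm j) * W j) * (G i0)@_(mlead (g i0)).
have [|p [L [x [pL kerx]]]] := spv z.
  rewrite rmorphM mulf_neq0 //; last first.
    by rewrite -(mcoeff_map_mpoly v) GK mleadc_eq0.
  by rewrite WE FK; under eq_bigr do rewrite WK.
rewrite rmorphM mulf_eq0 negb_or WE => /andP[xF xG].
have [] := @pow_mem_order_ge_pchar L p n l N k D E (map_mpoly x \o G) i0
  (map_mpoly x F) (map_mpoly (map_mpoly x) A') pL _ k_gt0.
- apply: contraNneq xG => /= G0.
  by rewrite -(mcoeff_map_mpoly x) G0 mcoeff0.
- rewrite -map_meval -rmorphXn; apply/eqP; rewrite -subr_eq0 -rmorphB /=.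
  apply/eqP/(map_mpoly_ker kerx); rewrite rmorphB rmorphXn /= map_meval FK AK.
  by rewrite fk (meval_eq _ GK) subrr.
- by move=> a /msupp_map_mpoly_sub/order_ge_lift_mpoly2; apply.
- move=> a b; rewrite mcoeff_map_mpoly => /msupp_map_mpoly_sub.
  exact: total_degree_le_lift_mpoly2.
- by move=> i b /msupp_map_mpoly_sub/msupp_lift_mpoly/degg.
- by move=> b /msupp_map_mpoly_sub/msupp_lift_mpoly/degf.
move=> C [FC ordC degC]; case/negP: xF; apply/eqP.
have xu i : \sum_j (u L (map_mpoly x \o G) i)@_(bmnm j) * x (W j) = 0.
  have uE : u K (map_mpoly v \o G) i = u K g i.
    by rewrite /u (meval_eq _ GK).
  rewrite -map_u -WE; apply: kerx; rewrite WE map_u uE.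
  by under eq_bigr do rewrite WK; apply: uw.
pose phi (h : {mpoly L[n]}) := \sum_j h@_(bmnm j) * x (W j).
have phi_sum (r : seq 'X_{1..n}) (H : 'X_{1..n} -> {mpoly L[n]}) :
    phi (\sum_(a <- r) H a) = \sum_(a <- r) phi (H a).
  rewrite /phi exchange_big; apply: eq_bigr => j _.
  by rewrite raddf_sum mulr_suml.
have phi_sum' (r : seq 'X_{1..l}) (H : 'X_{1..l} -> {mpoly L[n]}) :
    phi (\sum_(a <- r) H a) = \sum_(a <- r) phi (H a).
  rewrite /phi exchange_big; apply: eq_bigr => j _.
  by rewrite raddf_sum mulr_suml.
have phiZ c h : phi (c *: h) = c * phi h.
  by rewrite /phi mulr_sumr; apply: eq_bigr => j _; rewrite mcoeffZ mulrA.
rewrite -/(phi _) FC [C]mpolyE rmorph_sum /= phi_sum' big_seq big1 // => a aC.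
rewrite mevalZ [C@_a]mpolyE mulr_suml phi_sum big_seq big1 // => b bC.
have degab := degC a b bC.
have lt_a : (mdeg a < B.+1)%N by apply: leq_trans degab; rewrite leq_addr.
have lt_b : (mdeg b < B.+1)%N by apply: leq_trans degab; rewrite leq_addl.
rewrite -scalerAl phiZ; have := xu (BMultinom lt_a, BMultinom lt_b).
by rewrite /u /= (ordC _ aC) => xu0; rewrite [phi _]xu0 mulr0.
Qed.
(** * Ideals and their powers *)

Section Ideals.
Variable R : comNzRingType.
Implicit Types I J M : set R.

Lemma ideal0 I : ideal I -> I 0. Proof. by case. Qed.

Lemma idealD I x y : ideal I -> I x -> I y -> I (x + y).
Proof. by move=> [_ _ idI] Ix Iy; rewrite -[x]mul1r; apply: idI. Qed.

Lemma idealMl I a x : ideal I -> I x -> I (a * x).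
Proof. by move=> [_ I0 idI] Ix; rewrite -[_ * _]addr0; apply: idI. Qed.

Lemma idealMr I a x : ideal I -> I x -> I (x * a).
Proof. by rewrite mulrC; apply: idealMl. Qed.

Lemma idealN I x : ideal I -> I x -> I (- x).
Proof. by rewrite -mulN1r; apply: idealMl. Qed.

Lemma idealB I x y : ideal I -> I x -> I y -> I (x - y).
Proof. by move=> idI Ix Iy; apply: idealD => //; apply: idealN. Qed.

Lemma ideal_sum I (T : Type) (r : seq T) (P : pred T) (F : T -> R) :
  ideal I -> (forall i, P i -> I (F i)) -> I (\sum_(i <- r | P i) F i).
Proof.
move=> idI IF; elim/big_ind: _ => //; first exact: ideal0.
by move=> x y; apply: idealD.
Qed.

Lemma ideal_closed I : I 0 -> (forall x y, I x -> I y -> I (x + y)) ->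
  (forall a x, I x -> I (a * x)) -> ideal I.
Proof. by move=> I0 ID IM; split=> // a u v _ Iu Iv; apply: ID => //; apply: IM. Qed.

Lemma exists_neq0 I : ideal I -> I <> [set 0] -> exists2 x, I x & x != 0.
Proof.
move=> idI I_neq0; apply: contrapT => H; apply: I_neq0; apply/seteqP; split.
  by move=> x Ix /=; apply/eqP; apply: contrapT => /negP x0; apply: H; exists x.
by move=> x /= ->; apply: ideal0.
Qed.

Lemma ideal_span_ideal G : ideal (ideal_span [set: R] G).
Proof.
apply: ideal_closed => [M [[]]//|x y Gx Gy M MG|a x Gx M MG].
  by apply: idealD (Gx M MG) (Gy M MG); case: MG.
by apply: idealMl (Gx M MG); case: MG.
Qed.

Lemma sub_ideal_span (G : set R) : G `<=` ideal_span setT G.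
Proof. exact: sub_gen_smallest. Qed.

Lemma ideal_span_min G M : ideal M -> G `<=` M -> ideal_span setT G `<=` M.
Proof. by move=> idM GM; apply: smallest_sub. Qed.

Lemma ideal_mul_ideal I J : ideal (ideal_mul I J).
Proof. exact: ideal_span_ideal. Qed.

Lemma mem_ideal_mul I J x y : I x -> J y -> ideal_mul I J (x * y).
Proof. by move=> Ix Jy; apply: sub_ideal_span; exists x => //; exists y. Qed.

Lemma ideal_mul_min I J M :
  ideal M -> (forall x y, I x -> J y -> M (x * y)) -> ideal_mul I J `<=` M.
Proof.
by move=> idM IJM; apply: ideal_span_min => // _ [x Ix [y Jy <-]]; apply: IJM.
Qed.

Lemma ideal_pow_ideal I s : ideal (ideal_pow I s).
Proof.
by case: s => [|s]; [exact: ideal_closed | exact: ideal_mul_ideal].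
Qed.

Lemma mem_ideal_powM I s t x y :
  ideal_pow I s x -> ideal_pow I t y -> ideal_pow I (s + t) (x * y).
Proof.
move=> + Ity; elim: s x => [|s IH] x.
  by move=> _; apply: idealMl => //; apply: ideal_pow_ideal.
pose M : set R := fun z => ideal_pow I (s.+1 + t) (z * y).
suff IM : ideal_pow I s.+1 `<=` M by move/IM.
apply: ideal_mul_min => [|a b Ia Ib].
  apply: ideal_closed => [|z w Mz Mw|a z Mz]; rewrite /M.
  - by rewrite mul0r; exact: (ideal0 (ideal_pow_ideal _ _)).
  - by rewrite mulrDl; apply: (idealD (ideal_pow_ideal _ _)).
  - by rewrite -mulrA; apply: (idealMl _ (ideal_pow_ideal _ _)).
by rewrite /M -mulrA; apply: mem_ideal_mul => //; apply: IH.
Qed.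

Lemma mem_ideal_powX I s k x :
  ideal_pow I s x -> ideal_pow I (s * k) (x ^+ k).
Proof.
move=> Ix; elim: k => [|k IH]; first by rewrite muln0.
by rewrite exprS mulnS; apply: mem_ideal_powM.
Qed.

Lemma mem_ideal_pow1 I x : I x -> ideal_pow I 1 x.
Proof. by move=> Ix; rewrite -[x]mulr1; apply: mem_ideal_mul. Qed.

Lemma ideal_pow_anti I s t : (s <= t)%N -> ideal_pow I t `<=` ideal_pow I s.
Proof.
move=> /subnK <-; elim: (t - s)%N => [|d IH] //=.
apply: subset_trans IH; apply: ideal_mul_min => [|x y _ Iy].
  exact: ideal_pow_ideal.
exact: (idealMl _ (ideal_pow_ideal _ _)).
Qed.

Lemma order_ge_ideal_pow I (l N : nat) (g : 'I_l -> R) (C : {mpoly R[l]}) :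
  (forall i, I (g i)) -> order_ge N C -> ideal_pow I N C.@[g].
Proof.
move=> Ig ordC; rewrite mevalE big_seq.
apply: ideal_sum => [|a aC]; first exact: ideal_pow_ideal.
apply: idealMl; first exact: ideal_pow_ideal.
apply: (ideal_pow_anti (ordC a aC)); rewrite mdegE.
elim/big_rec2: _ => [//|i k x _ IH]; apply: mem_ideal_powM => //.
by rewrite -[X in ideal_pow I X]mul1n; exact: (mem_ideal_powX _ (mem_ideal_pow1 (Ig i))).
Qed.

Lemma ideal_pow_order_ge I (l N : nat) (g : 'I_l -> R) (f : R) :
  (forall x, I x -> exists a : 'I_l -> R, x = \sum_i a i * g i) ->
  ideal_pow I N f -> exists2 C : {mpoly R[l]}, f = C.@[g] & order_ge N C.
Proof.
move=> genI; elim: N f => [|N IH] f; first by exists f%:MP => //; rewrite mevalC.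
pose M : set R := fun z => exists2 C : {mpoly R[l]}, z = C.@[g] & order_ge N.+1 C.
suff : ideal_pow I N.+1 `<=` M by apply.
apply: ideal_mul_min => [|_ _ /genI[a ->] /IH[C -> ordC]].
  apply: ideal_closed => [|_ _ [C -> ordC] [B -> ordB]|a _ [C -> ordC]].
  - by exists 0; [rewrite rmorph0 | move=> b; rewrite msupp0].
  - exists (C + B); first by rewrite rmorphD.
    by move=> b /msuppD_le; rewrite mem_cat => /orP[/ordC|/ordB].
  - by exists (a *: C); [rewrite mevalZ | apply: order_geZ].
exists ((\sum_i a i *: 'X_i) * C).
  rewrite rmorphM rmorph_sum /=; congr (_ * _); apply: eq_bigr => i _.
  by rewrite mevalZ mevalXU.
rewrite -add1n; apply: order_geM => //; apply: order_ge_sum => i _.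
by apply/order_geZ/order_ge_mpolyX; rewrite mdeg1.
Qed.

End Ideals.

(** * Hilbert's basis theorem *)

(** Induction on the number k of coordinates compared. A monomial whose next coordinate is at least
    the maximum B over [s0] lies above an element of [s0]; each of the finitely many smaller values
    gets a list of its own. *)
Lemma dickson (n : nat) (P : 'X_{1..n} -> Prop) :
  exists s : seq 'X_{1..n}, (forall m, m \in s -> P m) /\
    forall m, P m -> exists2 m', m' \in s & (m' <= m)%MM.
Proof.
suff H k : (k <= n)%N -> forall P : 'X_{1..n} -> Prop,
    exists s : seq 'X_{1..n}, (forall m, m \in s -> P m) /\
      forall m, P m -> exists2 m', m' \in s &
        forall i : 'I_n, (i < k)%N -> (m' i <= m i)%N.
  have [s [sP Ps]] := H n (leqnn n) P; exists s; split=> // m /Ps[m' m's le].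
  by exists m' => //; apply/mnm_lepP => i; apply: le.
elim: k => [|k IH] lt_kn {}P.
  have [[m Pm]|NP] := pselect (exists m, P m).
    exists [:: m]; split=> [m'|m' _]; first by rewrite inE => /eqP->.
    by exists m; rewrite ?inE.
  by exists [::]; split=> // m Pm; case: NP; exists m.
pose o := Ordinal lt_kn.
have [s0 [s0P Ps0]] := IH (ltnW lt_kn) P.
pose B := \max_(m <- s0) m o.
have /choice[s1 s1P] := fun j => IH (ltnW lt_kn) (fun m => P m /\ m o = j).
exists (s0 ++ flatten [seq s1 j | j <- iota 0 B]); split=> m.
  rewrite mem_cat => /orP[/s0P//|/flattenP[_ /mapP[j _ ->]]].
  by move/(s1P j).1 => [].
move=> Pm; have [lt_mB|le_Bm] := ltnP (m o) B.
  have [m' m's le_m'] := (s1P (m o)).2 m (conj Pm erefl).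
  exists m' => [|i].
    rewrite mem_cat; apply/orP; right; apply/flattenP; exists (s1 (m o)) => //.
    by apply: map_f; rewrite mem_iota.
  rewrite ltnS leq_eqVlt => /predU1P[ik|/le_m'//].
  have -> : i = o by apply: val_inj.
  by have [_ ->] := (s1P (m o)).1 m' m's.
have [m' m's le_m'] := Ps0 m Pm; exists m'; first by rewrite mem_cat m's.
move=> i; rewrite ltnS leq_eqVlt => /predU1P[ik|/le_m'//].
have -> : i = o by apply: val_inj.
by apply: leq_trans le_Bm; apply: (leq_bigmax_seq (F := fun m : 'X_{1..n} => m o)).
Qed.

(** By [dickson], finitely many leading monomials of elements of I divide all the others; elements
    with these leading monomials generate I, by division with remainder. *)
Lemma ideal_finitely_generated (K : fieldType) (n : nat) (I : set {mpoly K[n]}) :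
  ideal I -> exists (l : nat) (g : 'I_l -> {mpoly K[n]}),
    (forall i, I (g i)) /\
    forall x, I x -> exists a : 'I_l -> {mpoly K[n]}, x = \sum_i a i * g i.
Proof.
move=> idI.
have [s [sP Ps]] := dickson (fun m => exists f, [/\ I f, f != 0 & mlead f = m]).
have /choice[h hP] (m : 'X_{1..n}) :
    exists f, m \in s -> [/\ I f, f != 0 & mlead f = m].
  by have [/sP[f]|_] := boolP (m \in s); [exists f | exists 0].
pose g (i : 'I_(size s)) := h (tnth (in_tuple s) i).
have gP i : [/\ I (g i), g i != 0 & mlead (g i) = tnth (in_tuple s) i].
  by apply/hP/mem_tnth.
exists (size s), g; split=> [i|]; first by case: (gP i).
elim/mleadrect => f IH If.
have [->|f0] := eqVneq f 0.
  by exists (fun=> 0); rewrite big1 // => i _; rewrite mul0r.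
have [m /(tnthP (in_tuple s))[i mE] le_mf] := Ps _ (ex_intro _ f (And3 If f0 erefl)).
have [Igi gi0 leadgi] := gP i; rewrite -mE in leadgi.
pose d := (mlead f - m)%MM; have dE : mlead f = (d + m)%MM by rewrite submK.
pose c := (f@_(mlead f) / (g i)@_m) *: 'X_[d]; pose f' := f - c * g i.
have gm : (g i)@_m != 0 by rewrite -leadgi mleadc_eq0.
have f'0 : f'@_(mlead f) = 0.
  have -> : f' = f - (f@_(mlead f) / (g i)@_m) *: (g i * 'X_[d]).
    by rewrite /f' /c -scalerAl ['X_[d] * _]mulrC.
  rewrite mcoeffB mcoeffZ; have -> : (g i * 'X_[d])@_(mlead f) = (g i)@_m.
    by rewrite dE mcoeffMX.
  by rewrite divfK // subrr.
have [a aE] : exists a : 'I_(size s) -> {mpoly K[n]}, f' = \sum_i a i * g i.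
  have [->|f'_neq0] := eqVneq f' 0.
    by exists (fun=> 0); rewrite big1 // => j _; rewrite mul0r.
  apply: IH; last by apply: idealB => //; apply: idealMl.
  rewrite lt_neqAle; apply/andP; split.
    by apply: contraNneq f'_neq0 => E; rewrite -mleadc_eq0 E f'0.
  apply: le_trans (mleadB_le _ _) _; rewrite leUx lexx /= dE.
  apply: le_trans (mleadM_le _ _) _; rewrite leadgi lemc_add2l.
  by apply: le_trans (mleadZ_le _ _) _; rewrite mleadXm.
exists (fun j => a j + if j == i then c else 0).
rewrite -[f](subrK (c * g i)) -/f' aE; under [RHS]eq_bigr do rewrite mulrDl.
rewrite big_split /=; congr (_ + _); rewrite (bigD1 i) //= eqxx big1 ?addr0 //.
by move=> j /negPf->; rewrite mul0r.
Qed.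

(** The loss l, a number of generators of I, depends neither on f nor on the exponents, so it is
    negligible for large powers. *)
Lemma integral_pow_sub (K : fieldType) (n : nat) (I : set {mpoly K[n]}) :
  ideal I -> I <> [set 0] ->
  exists l, forall f N k, (0 < k)%N ->
    ideal_pow I (N * k) (f ^+ k) -> ideal_pow I (N - l) f.
Proof.
move=> idI I_neq0; have [l [g [Ig genI]]] := ideal_finitely_generated idI.
have [i0 gi0] : exists i0, g i0 != 0.
  apply: contrapT => H; have [x /genI[a xE] /eqP[]] := exists_neq0 idI I_neq0.
  rewrite xE big1 // => i _; suff -> : g i = 0 by rewrite mulr0.
  by apply/eqP; apply: contrapT => /negP gi; apply: H; exists i.
exists l => f N k k_gt0 /(ideal_pow_order_ge genI)[A fk ordA].
have [C -> ordC] := pow_mem_order_ge gi0 k_gt0 fk ordA.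
exact: order_ge_ideal_pow.
Qed.
(** * Symbolic powers *)

Section SymbolicPowers.
Variable R : idomainType.
Implicit Types I M P : set R.

Lemma prime_ideal_compl P : prime_ideal P ->
  [/\ ideal P, ~ P 1 & forall a b, ~ P a -> ~ P b -> ~ P (a * b)].
Proof. by move=> [idP P1 PM]; split=> // a b Pa Pb /PM[]. Qed.

(** Clearing denominators: the fractions a / u with a in M and u outside P already form an ideal of
    the localization. *)
Lemma loc_idealP P M f : prime_ideal P -> ideal M ->
  loc_ideal P M (tofrac f) <-> exists2 u, ~ P u & M (u * f).
Proof.
move=> /prime_ideal_compl[idP P1 PM] idM.
have neq0 u : ~ P u -> tofrac u != 0.
  by move=> Pu; rewrite tofrac_eq0; apply: contra_notN Pu => /eqP->; apply: ideal0.
split=> [Mf|[u Pu Muf] N [[_ N0 idN] MN]]; last first.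
  rewrite (_ : tofrac f = tofrac 1 / tofrac u * tofrac (u * f) + 0).
    apply: idN => //; first by exists 1 => //; exists u.
    by apply: MN; exists (u * f).
  by rewrite addr0 tofracM tofrac1 mul1r mulKf ?neq0.
pose N : set {fraction R} :=
  fun z => exists a u, [/\ M a, ~ P u & z = tofrac a / tofrac u].
have /Mf[a [u [Ma Pu fE]]] : ideal_of (localization P) N /\ @tofrac R @` M `<=` N.
  split; last first.
    move=> _ [a Ma <-]; exists a, 1; split=> //.
    by rewrite tofrac1 divr1.
  split=> [_ [a [u [Ma Pu ->]]]||_ _ _ [x _ [w Pw <-]] [a [u [Ma Pu ->]]]
             [b [v [Mb Pv ->]]]].
  - by exists a => //; exists u.
  - by exists 0, 1; split=> //; [exact: ideal0 | rewrite tofrac0 mul0r].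
  exists (x * v * a + w * u * b), (w * u * v); split.
  - by apply: idealD => //; apply: idealMl.
  - by apply: (PM) => //; apply: (PM).
  rewrite !(tofracM, tofracD).
  have addE (L : fieldType) (x' w' a' u' b' v' : L) :
      w' != 0 -> u' != 0 -> v' != 0 -> x' / w' * (a' / u') + b' / v' =
      (x' * v' * a' + w' * u' * b') / (w' * u' * v').
    by move=> w0 u0 v0; field; rewrite w0 u0 v0.
  by apply: addE; apply: neq0.
exists u => //; suff -> : u * f = a by [].
by apply/eqP; rewrite -tofrac_eq tofracM fE mulrC divfK ?neq0.
Qed.

Lemma symbolic_powP I s f :
  symbolic_pow I s f <->
  forall P, Ass I P -> exists2 u, ~ P u & ideal_pow I s (u * f).
Proof.
split=> If P PI; have [primeP _] := PI.
  exact: (loc_idealP _ primeP (ideal_pow_ideal I s)).1 (If P PI).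
exact: (loc_idealP _ primeP (ideal_pow_ideal I s)).2 (If P PI).
Qed.

Lemma symbolic_pow_anti I s t :
  (s <= t)%N -> symbolic_pow I t `<=` symbolic_pow I s.
Proof.
move=> le_st f /symbolic_powP If; apply/symbolic_powP => P /If[u Pu Iuf].
by exists u => //; apply: ideal_pow_anti Iuf.
Qed.

Lemma mem_symbolic_powX I s k f :
  symbolic_pow I s f -> symbolic_pow I (s * k) (f ^+ k).
Proof.
move=> /symbolic_powP If; apply/symbolic_powP => P PI.
have [u Pu Iuf] := If P PI; have [/prime_ideal_compl[_ P1 PM] _] := PI.
exists (u ^+ k); last by rewrite -exprMn; apply: mem_ideal_powX.
by elim: k => [|k IH]; rewrite ?expr0 // exprS; apply: PM.
Qed.

End SymbolicPowers.

(* An element of I^(sr) has powers f^k in I^(t'r') with t'r'/k as large as the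
   slope t'/s' allows, so f is integral over a power of I slightly above I^(tr). *)
Lemma symbolic_sub_eventually (K : fieldType) (n : nat) (I : set {mpoly K[n]})
    (s t s' t' : nat) :
  ideal I -> I <> [set 0] -> (0 < s)%N -> (s' * t < s * t')%N ->
  (forall r0, exists2 r, (r0 <= r)%N &
     symbolic_pow I (s' * r) `<=` ideal_pow I (t' * r)) ->
  exists r0, forall r, (r0 <= r)%N ->
     symbolic_pow I (s * r) `<=` ideal_pow I (t * r).
Proof.
move=> idI I_neq0 s_gt0 lt_st inf.
have [l intI] := integral_pow_sub idI I_neq0.
(* For r > l s', the strict inequality of slopes gives (t r + l) s' + 1 <= s r t'; the 1 is room for
   the rounding in k. *)
exists (l * s').+1 => r le_r f If.
have [r' le_r' subr'] := inf ((t * r + l) * (s * r))%N.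
have sr_gt0 : (0 < s * r)%N by rewrite muln_gt0 s_gt0 (leq_ltn_trans _ le_r).
(* The first k with s r k > s' r', so that f^k lies in the (s' r')-th symbolic power. Rounding up
   costs at most s r, which the size of r' absorbs. *)
pose k := (s' * r' %/ (s * r)).+1.
have le1 : (s' * r' <= s * r * k)%N by rewrite [X in (_ <= X)%N]mulnC ltnW // ltn_ceil.
have le2 : (s * r * k <= s' * r' + s * r)%N.
  by rewrite mulnS addnC leq_add2r [X in (X <= _)%N]mulnC leq_divM.
have le3 : ((t * r + l) * k <= t' * r')%N.
  rewrite -(leq_pmul2l sr_gt0) mulnCA.
  apply: leq_trans (leq_mul (leqnn _) le2) _.
  rewrite mulnDr; apply: leq_trans (leq_add (leqnn _) le_r') _.
  have : ((t * r + l) * s' + 1 <= s * r * t')%N by nia.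
  by move/(leq_mul (leqnn r')); nia.
rewrite -[X in ideal_pow I X](addnK l); apply: (intI _ _ k) => //.
apply: (ideal_pow_anti le3); apply: subr'; apply: (symbolic_pow_anti le1).
exact: (mem_symbolic_powX If).
Qed.
(** * Extension to a polynomial ring *)

Section IdealProducts.
Variable R : comNzRingType.
Implicit Types X Y : set R.

Lemma ideal_pow_mul X Y s :
  ideal_pow (ideal_mul X Y) s = ideal_mul (ideal_pow X s) (ideal_pow Y s).
Proof.
apply/seteqP; split.
  elim: s => [|s IH] => [x _|]; first by rewrite -[x]mulr1; apply: mem_ideal_mul.
  have idM : ideal (ideal_mul (ideal_pow X s.+1) (ideal_pow Y s.+1)).
    exact: ideal_mul_ideal.
  apply: ideal_mul_min => // z w XYz /IH w_in.
  move: w w_in; apply: ideal_span_min => [|_ [a Xa [b Yb <-]]].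
    apply: ideal_closed => [|u v|c u]; first by rewrite mulr0; apply: ideal0.
      by rewrite mulrDr; apply: idealD.
    by rewrite mulrCA; apply: idealMl.
  move: z XYz; apply: ideal_span_min => [|_ [x Xx [y Yy <-]]].
    apply: ideal_closed => [|u v|c u]; first by rewrite mul0r; apply: ideal0.
      by rewrite mulrDl; apply: idealD.
    by rewrite -mulrA; apply: idealMl.
  by rewrite mulrACA; apply: mem_ideal_mul; apply: mem_ideal_mul.
apply: ideal_mul_min => [|x y]; first exact: ideal_pow_ideal.
elim: s x y => [//|s IH] x y Xx Yy.
have idP : ideal (ideal_pow (ideal_mul X Y) s.+1) by apply: ideal_pow_ideal.
move: x Xx; apply: ideal_span_min => [|_ [a Xa [b Xb <-]]].
  apply: ideal_closed => [|u v|c u]; first by rewrite mul0r; apply: ideal0.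
    by rewrite mulrDl; apply: idealD.
  by rewrite -mulrA; apply: idealMl.
move: y Yy; apply: ideal_span_min => [|_ [a' Ya' [b' Yb' <-]]].
  apply: ideal_closed => [|u v|c u]; first by rewrite mulr0; apply: ideal0.
    by rewrite mulrDr; apply: idealD.
  by rewrite mulrCA; apply: idealMl.
by rewrite mulrACA; apply: mem_ideal_mul; [apply: mem_ideal_mul | apply: IH].
Qed.

(** If each [N a] had an element outside P, the product of these would lie in every [N a], hence in
    P, against primality. *)
Lemma prime_seq_cap (P : set R) (T : eqType) (s : seq T) (N : T -> set R) :
  prime_ideal P -> (forall a x y, N a x -> N a (y * x)) ->
  (forall x, P x <-> forall a, a \in s -> N a x) ->
  exists2 a, a \in s & P = N a.
Proof.
move=> [idP P1 PM] NM PE.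
suff [a sa NP] : exists2 a, a \in s & N a `<=` P.
  by exists a => //; apply/seteqP; split=> // x /PE; apply.
apply: contrapT => H.
have {}H a : a \in s -> exists x, N a x /\ ~ P x.
  move=> sa; apply: contrapT => H'; apply: H; exists a => // x Nx.
  by apply: contrapT => Px; apply: H'; exists x.
suff [x [Nx Px]] : exists x, (forall a, a \in s -> N a x) /\ ~ P x.
  by apply/Px/PE.
elim: s {PE} H => [_|a s IH H]; first by exists 1.
have [x [Nx Px]] := H a (mem_head a s).
have [b sb|y [Ny Py]] := IH; first by apply: H; rewrite inE sb orbT.
exists (x * y); split; last by move/PM => [].
move=> b; rewrite inE => /predU1P[->|/Ny Nb]; last exact: NM.
by rewrite mulrC; apply: NM.
Qed.

(* McCoy's theorem: a zero divisor modulo the extension of L is killed by a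
   scalar; U_c h has a smaller leading term than h for the largest c such
   that U_c h is not zero modulo L. *)
Lemma mccoy (n : nat) (L : set R) (U h : {mpoly R[n]}) :
  ideal L -> (forall b, L (U * h)@_b) -> ~ (forall b, L h@_b) ->
  exists2 a, ~ L a & forall b, L (a * U@_b).
Proof.
move=> idL; elim/mleadrect: h => h IH LUh Lh.
have h0 : h != 0.
  by apply: contra_notN Lh => /eqP-> b; rewrite mcoeff0; apply: ideal0.
have lead_lt (q : {mpoly R[n]}) : (mlead q <= mlead h)%O -> q@_(mlead h) = 0 ->
    ~ (forall b, L q@_b) -> (mlead q < mlead h)%O.
  move=> le_qh qh Lq; rewrite lt_neqAle le_qh andbT.
  apply: contra_notN Lq => /eqP qhE b.
  suff -> : q = 0 by rewrite mcoeff0; apply: ideal0.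
  by apply/eqP; rewrite -mleadc_eq0 qhE qh.
set t := mlead h in lead_lt *.
have [Lt|Lt] := pselect (L h@_t).
  have LXt b : L (h@_t *: 'X_[t])@_b.
    by rewrite mcoeffZ mulrC; apply: idealMl.
  apply: (IH (h - h@_t *: 'X_[t])).
  - apply: lead_lt.
    + apply: le_trans (mleadB_le _ _) _; rewrite leUx lexx /=.
      by apply: le_trans (mleadZ_le _ _) _; rewrite mleadXm.
    + by rewrite mcoeffB mcoeffZ mcoeffX eqxx mulr1 subrr.
    + apply: contra_not Lh => Lh b; rewrite -(subrK (h@_t *: 'X_[t]) h).
      by rewrite mcoeffD; apply: idealD.
  - move=> b; rewrite mulrBr mcoeffB; apply: idealB => //.
    rewrite -scalerAr mcoeffZ mulrC; exact: idealMl.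
  - apply: contra_not Lh => Lh b; rewrite -(subrK (h@_t *: 'X_[t]) h).
    by rewrite mcoeffD; apply: idealD.
have [LU|LU] := pselect (forall c b, L (U@_c * h@_b)).
  by exists h@_t => // c; rewrite mulrC.
pose D c := ~ forall b, L (U@_c * h@_b).
(* [V] marks the c for which U_c h is not zero modulo L, so that its leading monomial is the largest
   of them. *)
pose V : {mpoly R[n]} := \sum_(c <- msupp U) (if `[< D c >] then 1 else 0) *: 'X_[c].
have VD c : D c -> V@_c != 0.
  move=> Dc; rewrite mcoeff_sum_msupp; case: ifPn => [_|/memN_msupp_eq0 Uc].
    by rewrite asboolT // oner_eq0.
  by case: Dc => b; rewrite Uc mul0r; apply: ideal0.
pose c := mlead V; have Dc : D c.
  have V0 : V != 0.
    apply: contra_notN LU => /eqP V0 c' b; apply: contrapT => Lc'b.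
    have /VD : D c' by apply: contra_not Lc'b; apply.
    by rewrite V0 mcoeff0 eqxx.
  have := mlead_supp V0; rewrite mcoeff_msupp mcoeff_sum_msupp.
  by case: ifP => _; [case: asboolP => //|]; rewrite eqxx.
have Lgt c' b : (c < c')%O -> L (U@_c' * h@_b).
  move=> lt_c; apply: contrapT => Lc'b.
  have /VD : D c' by apply: contra_not Lc'b; apply.
  by rewrite mcoeff_gt_mlead // eqxx.
(* In the coefficient of U h at c + t, a term other than U_c h_t has its index in U above c, hence
   lies in L, or its index in h above t, hence is 0. *)
have LUt : L (U@_c * h@_t).
  have c_lt : (mdeg c < (mdeg (c + t)).+1)%N by rewrite ltnS mdegD leq_addr.
  have t_lt : (mdeg t < (mdeg (c + t)).+1)%N by rewrite ltnS mdegD leq_addl.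
  have := LUh (c + t)%MM.
  rewrite mcoeffM (bigD1 (BMultinom c_lt, BMultinom t_lt)) //= => LS.
  rewrite -(addrK (\sum_(k | ((c + t)%MM == (bmnm k.1 + bmnm k.2)%MM) &&
    (k != (BMultinom c_lt, BMultinom t_lt))) U@_k.1 * h@_k.2) (_ * _)).
  apply: idealB => //; apply: ideal_sum => // -[k1 k2] /= /andP[/eqP ctE kct].
  have [lt_k1|lt_k1|k1E] := ltgtP (bmnm k1) c; last 1 first.
  - case/eqP: kct; congr (_, _); apply: val_inj => //=.
    by move: ctE; rewrite k1E => /addmI.
  - rewrite (@mcoeff_gt_mlead _ _ h) ?mulr0; first exact: ideal0.
    rewrite ltNge; apply/negP => le_k2.
    have := ltmc_le_add lt_k1 le_k2; rewrite -/t -ctE; by rewrite ltxx.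
  - exact: Lgt.
apply: (IH (U@_c *: h - (U@_c * h@_t) *: 'X_[t])).
- apply: lead_lt.
  + apply: le_trans (mleadB_le _ _) _; rewrite leUx; apply/andP; split.
      exact: mleadZ_le.
    by apply: le_trans (mleadZ_le _ _) _; rewrite mleadXm.
  + by rewrite mcoeffB !mcoeffZ mcoeffX eqxx mulr1 subrr.
  + apply: contra_not Dc => Lq b.
    rewrite -mcoeffZ -(subrK ((U@_c * h@_t) *: 'X_[t]) (_ *: h)) mcoeffD.
    by apply: idealD => //; rewrite mcoeffZ mulrC; apply: idealMl.
- move=> b; rewrite mulrBr mcoeffB -!scalerAr !mcoeffZ; apply: idealB => //.
    exact: idealMl.
  by rewrite mulrC; apply: idealMl.
- apply: contra_not Dc => Lq b.
  rewrite -mcoeffZ -(subrK ((U@_c * h@_t) *: 'X_[t]) (_ *: h)) mcoeffD.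
  by apply: idealD => //; rewrite mcoeffZ mulrC; apply: idealMl.
Qed.

End IdealProducts.
Lemma extension_ideal (A R : comNzRingType) (f : A -> R) (I : set A) :
  ideal (extension f I).
Proof. exact: ideal_span_ideal. Qed.

Lemma mem_extension (A R : comNzRingType) (f : A -> R) (I : set A) x :
  I x -> extension f I (f x).
Proof. by move=> Ix; apply: sub_ideal_span; exists x. Qed.

Lemma extension_pow (A R : comNzRingType) (f : {rmorphism A -> R}) (I : set A) s :
  extension f (ideal_pow I s) = ideal_pow (extension f I) s.
Proof.
apply/seteqP; split.
  apply: ideal_span_min => [|_ [x Ix <-]]; first exact: ideal_pow_ideal.
  elim: s x Ix => [//|s IH] x Ix.
  have idP : ideal (ideal_pow (extension f I) s.+1) by apply: ideal_pow_ideal.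
  move: x Ix; apply: ideal_span_min => [|_ [a Ia [b Ib <-]]].
    apply: ideal_closed => [|u v|c u]; first by rewrite rmorph0; apply: ideal0.
      by rewrite rmorphD; apply: idealD.
    by rewrite rmorphM; apply: idealMl.
  rewrite rmorphM; apply: mem_ideal_mul; first exact: mem_extension.
  exact: IH.
elim: s => [|s IH].
  move=> x _; rewrite -[x]mulr1 -(rmorph1 f).
  by apply: (idealMl _ (extension_ideal _ _)); apply: mem_extension.
have idE : ideal (extension f (ideal_pow I s.+1)) by apply: extension_ideal.
apply: ideal_mul_min => // x y Xx /IH Xy.
move: x Xx; apply: ideal_span_min => [|_ [a Ia <-]].
  apply: ideal_closed => [|u v|c u]; first by rewrite mul0r; apply: ideal0.
    by rewrite mulrDl; apply: idealD.
  by rewrite -mulrA; apply: idealMl.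
move: y Xy; apply: ideal_span_min => [|_ [b Ib <-]].
  apply: ideal_closed => [|u v|c u]; first by rewrite mulr0; apply: ideal0.
    by rewrite mulrDr; apply: idealD.
  by rewrite mulrCA; apply: idealMl.
by rewrite -rmorphM; apply: mem_extension; apply: mem_ideal_mul.
Qed.

Section PolynomialExtension.
(* R is a polynomial ring over A: phi gives the coefficients, and e the images
   of the monomials. *)
Variables (A R : idomainType) (n : nat) (f : {rmorphism A -> R}).
Variables (phi : {rmorphism R -> {mpoly A[n]}}) (e : 'X_{1..n} -> R).
Hypothesis phi_f : forall a, phi (f a) = a%:MP.
Hypothesis phi_e : forall h, h = \sum_(b <- msupp (phi h)) f (phi h)@_b * e b.
Implicit Types (I L P : set A) (Y Q : set R).

Lemma extensionP I h : ideal I -> extension f I h <-> forall b, I (phi h)@_b.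
Proof.
move=> idI; split=> [|Ih].
  move: h; apply: ideal_span_min => [|_ [a Ia <-] b].
    apply: ideal_closed => [b|u v Iu Iv b|c u Iu b].
    - by rewrite rmorph0 mcoeff0; apply: ideal0.
    - by rewrite rmorphD mcoeffD; apply: idealD.
    rewrite rmorphM mcoeffM; apply: ideal_sum => // k _; exact: idealMl.
  by rewrite phi_f mcoeffC mulrC; apply: idealMl.
rewrite [h]phi_e; apply: ideal_sum => [|b _]; first exact: extension_ideal.
by rewrite mulrC; apply: (idealMl _ (extension_ideal _ _)); apply: mem_extension.
Qed.

Lemma extension_f I a : ideal I -> extension f I (f a) -> I a.
Proof.
move=> idI /(extensionP _ idI)/(_ 0%MM).
by rewrite phi_f mcoeffC eqxx mulr1.
Qed.

Lemma extension_colon I a h : ideal I ->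
  extension f I (f a * h) <-> forall b, I (a * (phi h)@_b).
Proof.
move=> idI; split=> [/(extensionP _ idI) Iah b|Iah].
  by have := Iah b; rewrite rmorphM phi_f mcoeffCM.
by apply/extensionP => // b; rewrite rmorphM phi_f mcoeffCM.
Qed.

(** If y has a coefficient outside P, [mccoy] gives a scalar outside P that multiplies all
    coefficients of x into P. *)
Lemma extension_prime P : prime_ideal P -> prime_ideal (extension f P).
Proof.
move=> [idP P1 PM]; split=> [||x y Pxy]; first exact: extension_ideal.
  by rewrite -(rmorph1 f) => /extension_f; apply: contra_not P1; apply.
have [Py|Py] := pselect (forall b, P (phi y)@_b); [right|left];
  apply/extensionP => //.
move/(extensionP _ idP): Pxy; rewrite rmorphM => Pxy.
by have [a Pa aPx] := mccoy idP Pxy Py => b; case: (PM _ _ (aPx b)).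
Qed.

Lemma extension_regular L r h c : ideal L -> (phi r)@_c \is a GRing.unit ->
  extension f L (r * h) -> extension f L h.
Proof.
move=> idL rc /(extensionP _ idL); rewrite rmorphM => Lrh.
apply/extensionP => //; apply: contrapT => Lh.
have [a La /(_ c) Lac] := mccoy idL Lrh Lh; apply: La.
by rewrite -(mulrK rc a) mulrC; apply: idealMl.
Qed.

(* The prime Q is the annihilator of h modulo the extension of I, hence its
   contraction is the intersection of the annihilators of the finitely many
   coefficients of h. *)
Lemma Ass_contraction I Q h : ideal I -> prime_ideal Q ->
  Q = [set x | extension f I (x * h)] -> Ass I (f @^-1` Q).
Proof.
move=> idI [idQ Q1 QM] QE.
have primeP : prime_ideal (f @^-1` Q).
  split=> [||a b]; rewrite /preimage /= ?rmorph1 ?rmorphM //; last exact: QM.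
  apply: ideal_closed => [|a b|a b] /=; first by rewrite rmorph0; apply: ideal0.
    by rewrite rmorphD; apply: idealD.
  by rewrite rmorphM; apply: idealMl.
split=> //.
have [| |b _ ->] := @prime_seq_cap _ _ _ (msupp (phi h))
  (fun b => [set a | I (a * (phi h)@_b)]) primeP.
- by move=> b x y Ix /=; rewrite -mulrA; apply: idealMl.
- move=> x; rewrite (_ : (f @^-1` Q) x = extension f I (f x * h)); last by rewrite QE.
  split=> [/(extension_colon _ _ idI) Ix b _|Ix]; first exact: Ix.
  apply/extension_colon => // b.
  have [/Ix //|/memN_msupp_eq0 ->] := boolP (b \in msupp (phi h)).
  by rewrite mulr0; apply: ideal0.
by exists (phi h)@_b.
Qed.

Section Intersection.
(** In use, Y is the extension of the ideal in the other variables, M the product, [r] the image of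
    a nonzero element of that other ideal, and [f0] a nonzero element of I. The setting is applied
    twice, with the two sets of variables exchanged. *)
Variables (I : set A) (Y M : set R) (r : R) (c : 'X_{1..n}) (f0 : A).
Hypotheses (idI : ideal I) (idY : ideal Y).
Hypothesis powM : forall s, ideal_pow M s =
  extension f (ideal_pow I s) `&` ideal_pow Y s.
Hypothesis ME : M = extension f I `&` Y.
Hypotheses (Yr : Y r)
  (r_regular : forall L h, ideal L -> extension f L (r * h) -> extension f L h).
Hypotheses (If0 : I f0) (f0_regular : forall h, Y (f f0 * h) -> Y h).

(** If P is the annihilator of g modulo I, its extension is that of r g modulo M: r lies in Y, so
    membership in Y is automatic, and r is regular modulo the extension of I. *)
Lemma Ass_extension P : Ass I P -> Ass M (extension f P).
Proof.
move=> [primeP [g PE]]; split; first exact: extension_prime.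
have [idP _ _] := primeP.
exists (r * f g); apply/seteqP; split=> x.
  move=> /(extensionP _ idP) Px /=; rewrite ME; split; last first.
    by rewrite mulrCA; apply: idealMr.
  rewrite mulrCA; apply: (idealMl _ (extension_ideal _ _)).
  rewrite mulrC; apply/extension_colon => // b.
  by have := Px b; rewrite PE /= mulrC.
rewrite /= ME mulrCA => -[/(r_regular idI) + _].
rewrite mulrC => /(extension_colon _ _ idI) Ig.
by apply/extensionP => // b; rewrite PE /= mulrC.
Qed.

(** Only the extensions of associated primes P of I are used. The multiplier U has a coefficient
    outside P, so [mccoy], applied to the contraction L of I^s from the localization at P, puts the
    coefficients of h in L. *)
Lemma symbolic_pow_sub_extension s :
  symbolic_pow M s `<=` extension f (symbolic_pow I s).
Proof.
move=> h /symbolic_powP Mh.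
suff Ih b : symbolic_pow I s (phi h)@_b.
  rewrite [h]phi_e; apply: ideal_sum => [|b _]; first exact: extension_ideal.
  by apply: (idealMr _ (extension_ideal _ _)); apply: mem_extension.
apply/symbolic_powP => P PI; have [/prime_ideal_compl[idP P1 PM] _] := PI.
have [U PU] := Mh _ (Ass_extension PI).
rewrite powM => -[/(extensionP _ (ideal_pow_ideal I s)) IUh _].
pose L : set A := fun a => exists2 u, ~ P u & ideal_pow I s (u * a).
have idL : ideal L.
  have idIs := ideal_pow_ideal I s.
  apply: ideal_closed => [|x y [u Pu Iux] [v Pv Ivy]|a x [u Pu Iux]].
  - by exists 1; rewrite // mulr0; apply: ideal0.
  - exists (u * v); first exact: PM.
    rewrite mulrDr; apply: idealD => //; last by rewrite -mulrA; apply: idealMl.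
    by rewrite [u * v]mulrC -mulrA; apply: idealMl.
  - by exists u => //; rewrite mulrCA; apply: idealMl.
have sub_L a : ideal_pow I s a -> L a by exists 1; rewrite ?mul1r.
suff: forall b, L (phi h)@_b by apply.
apply: contrapT => Lh.
have [|a La aU] := mccoy (U := phi U) idL _ Lh.
  by move=> b'; rewrite -rmorphM; apply: sub_L.
have [c' Pc'] : exists c', ~ P (phi U)@_c'.
  apply: contrapT => H; apply: PU; apply/extensionP => // c'.
  by apply: contrapT => Pc'; apply: H; exists c'.
have [u Pu Iu] := aU c'; apply: La; exists (u * (phi U)@_c'); first exact: PM.
by rewrite -mulrA [_ * a]mulrC.
Qed.

(** For g in the symbolic power of I, r^s g lies in that of M, hence in M^t, and r can be cancelled
    modulo the extension of I^t. *)
Lemma symbolic_sub_of_product s t :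
  symbolic_pow M s `<=` ideal_pow M t -> symbolic_pow I s `<=` ideal_pow I t.
Proof.
move=> sub_st g /symbolic_powP Ig.
have Irs k : ideal_pow Y k (r ^+ k).
  by rewrite -[X in ideal_pow Y X]mul1n; apply: mem_ideal_powX (mem_ideal_pow1 Yr).
have f0X k h : Y (f (f0 ^+ k) * h) -> Y h.
  elim: k h => [|k IH] h; first by rewrite rmorph1 mul1r.
  by rewrite exprS rmorphM -mulrA => /f0_regular/IH.
have rX L k h : ideal L -> extension f L (r ^+ k * h) -> extension f L h.
  move=> idL; elim: k h => [|k IH] h; first by rewrite mul1r.
  by rewrite exprS -mulrA => /(r_regular idL)/IH.
suff /sub_st : symbolic_pow M s (r ^+ s * f g).
  rewrite powM => -[/(rX _ _ _ (ideal_pow_ideal I t)) + _].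
  exact: extension_f (ideal_pow_ideal I t).
apply/symbolic_powP => Q [primeQ [h QE]].
have [idQ Q1 QM] := primeQ.
(* Otherwise elements x and y of the two annihilators lie outside Q, but x y annihilates h modulo
   the intersection M, so it lies in Q. *)
have QI : [set x | extension f I (x * h)] `<=` Q \/ [set x | Y (x * h)] `<=` Q.
  apply: contrapT => /not_orP[].
  move=> /existsNP[x /not_implyP[Ixh Qx]] /existsNP[y /not_implyP[Yyh Qy]].
  suff /QM[] : Q (x * y) by [].
  rewrite QE /= ME; split.
    by rewrite mulrAC; apply: (idealMr _ (extension_ideal _ _)).
  by rewrite -mulrA; apply: idealMl.
case: QI => QI.
  have {QI}QE' : Q = [set x | extension f I (x * h)].
    by apply/seteqP; split=> // x; rewrite {1}QE /= ME => -[].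
  have [u Qu Iu] := Ig _ (Ass_contraction idI primeQ QE').
  exists (f u) => //; rewrite powM; split; last first.
    by apply: (idealMl _ (ideal_pow_ideal _ _)); apply: (idealMr _ (ideal_pow_ideal _ _)).
  rewrite mulrCA -rmorphM; apply: (idealMl _ (extension_ideal _ _)).
  exact: mem_extension.
(* This lies outside Q: as f0 is regular modulo Y, it would otherwise follow that h is in Y, and 1
   in Q. *)
exists (f (f0 ^+ s)).
  rewrite QE /= ME => -[_ /f0X Yh]; apply: Q1; apply: QI => /=.
  by rewrite mul1r.
rewrite powM; split; last first.
  by apply: (idealMl _ (ideal_pow_ideal _ _)); apply: (idealMr _ (ideal_pow_ideal _ _)).
rewrite mulrCA -rmorphM; apply: (idealMl _ (extension_ideal _ _)).
apply: mem_extension; apply: (idealMr _ (ideal_pow_ideal _ _)).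
by rewrite -[X in ideal_pow I X]mul1n; apply: mem_ideal_powX (mem_ideal_pow1 If0).
Qed.

End Intersection.
End PolynomialExtension.
Lemma mpoly_rmorph_eq (n : nat) (R S : comNzRingType)
    (f g : {rmorphism {mpoly R[n]} -> S}) :
  (forall c, f c%:MP = g c%:MP) -> (forall i, f 'X_i = g 'X_i) -> f =1 g.
Proof.
move=> fgC fgX p; rewrite [p]mpolyE !rmorph_sum /=; apply: eq_bigr => m _.
rewrite -mul_mpolyC !rmorphM fgC; congr (_ * _).
rewrite mpolyXE_id !rmorph_prod /=; apply: eq_bigr => i _.
by rewrite !rmorphXn fgX.
Qed.

(** * The mixed product *)

Section MixedProduct.
Variables (K : fieldType) (m n : nat).
Local Notation A := {mpoly K[m]}.
Local Notation B := {mpoly K[n]}.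
Local Notation R := {mpoly K[m + n]}.

HB.instance Definition _ := GRing.RMorphism.copy (@inj_x K m n)
  (comp_mpoly [tuple 'X_(lshift n i) | i < m]).
HB.instance Definition _ := GRing.RMorphism.copy (@inj_y K m n)
  (comp_mpoly [tuple 'X_(rshift m j) | j < n]).

(** The canonical map from K[x, y] to K[x][y]; [coef_xK] recovers an element from its
    coefficients. *)
Definition coef_x : R -> {mpoly A[n]} :=
  mmap (@mpolyC n A \o @mpolyC m K)
    (fun k => match split k with inl i => ('X_i)%:MP | inr j => 'X_j end).
HB.instance Definition _ := GRing.RMorphism.copy coef_x
  (mmap (@mpolyC n A \o @mpolyC m K)
    (fun k => match split k with inl i => ('X_i)%:MP | inr j => 'X_j end)).

Definition coef_y : R -> {mpoly B[m]} :=
  mmap (@mpolyC m B \o @mpolyC n K)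
    (fun k => match split k with inl i => 'X_i | inr j => ('X_j)%:MP end).
HB.instance Definition _ := GRing.RMorphism.copy coef_y
  (mmap (@mpolyC m B \o @mpolyC n K)
    (fun k => match split k with inl i => 'X_i | inr j => ('X_j)%:MP end)).

Lemma inj_xC c : @inj_x K m n c%:MP = c%:MP.
Proof. exact: comp_mpolyC. Qed.

Lemma inj_yC c : @inj_y K m n c%:MP = c%:MP.
Proof. exact: comp_mpolyC. Qed.

Lemma inj_xZ c p : @inj_x K m n (c *: p) = c *: inj_x n p.
Proof. exact: comp_mpolyZ. Qed.

Lemma inj_yZ c p : @inj_y K m n (c *: p) = c *: inj_y m p.
Proof. exact: comp_mpolyZ. Qed.

Lemma inj_xX i : @inj_x K m n 'X_i = 'X_(lshift n i).
Proof. by rewrite /inj_x /comp_mpoly mmapX mmap1U tnth_mktuple. Qed.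

Lemma inj_yX j : @inj_y K m n 'X_j = 'X_(rshift m j).
Proof. by rewrite /inj_y /comp_mpoly mmapX mmap1U tnth_mktuple. Qed.

Lemma coef_xX k :
  coef_x 'X_k = match split k with inl i => ('X_i)%:MP | inr j => 'X_j end.
Proof. by rewrite /coef_x mmapX mmap1U. Qed.

Lemma coef_yX k :
  coef_y 'X_k = match split k with inl i => 'X_i | inr j => ('X_j)%:MP end.
Proof. by rewrite /coef_y mmapX mmap1U. Qed.

Lemma coef_x_inj_x a : coef_x (inj_x n a) = a%:MP.
Proof.
pose f : {rmorphism A -> {mpoly A[n]}} := coef_x \o @inj_x K m n.
apply: (mpoly_rmorph_eq (f := f) (g := @mpolyC n A)) => [c|i] /=.
  by rewrite inj_xC /coef_x mmapC.
by rewrite inj_xX coef_xX (unsplitK (inl i)).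
Qed.

Lemma coef_y_inj_y b : coef_y (inj_y m b) = b%:MP.
Proof.
pose f : {rmorphism B -> {mpoly B[m]}} := coef_y \o @inj_y K m n.
apply: (mpoly_rmorph_eq (f := f) (g := @mpolyC m B)) => [c|j] /=.
  by rewrite inj_yC /coef_y mmapC.
by rewrite inj_yX coef_yX (unsplitK (inr j)).
Qed.

Lemma coef_x_inj_y b : coef_x (inj_y m b) = map_mpoly (@mpolyC m K) b.
Proof.
pose f : {rmorphism B -> {mpoly A[n]}} := coef_x \o @inj_y K m n.
apply: (mpoly_rmorph_eq (f := f) (g := map_mpoly (@mpolyC m K))) => [c|j] /=.
  by rewrite inj_yC /coef_x mmapC map_mpolyC.
by rewrite inj_yX coef_xX (unsplitK (inr j)) map_mpolyX.
Qed.

Lemma coef_y_inj_x a : coef_y (inj_x n a) = map_mpoly (@mpolyC n K) a.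
Proof.
pose f : {rmorphism A -> {mpoly B[m]}} := coef_y \o @inj_x K m n.
apply: (mpoly_rmorph_eq (f := f) (g := map_mpoly (@mpolyC n K))) => [c|i] /=.
  by rewrite inj_xC /coef_y mmapC map_mpolyC.
by rewrite inj_xX coef_yX (unsplitK (inl i)) map_mpolyX.
Qed.

Lemma coef_xK h :
  h = \sum_(b <- msupp (coef_x h)) inj_x n (coef_x h)@_b * inj_y m 'X_[b].
Proof.
pose f : {rmorphism {mpoly A[n]} -> R} :=
  mmap (@inj_x K m n) (fun j => inj_y m 'X_j).
pose g : {rmorphism R -> R} := f \o coef_x.
have gE : g =1 (idfun : {rmorphism R -> R}).
  apply: mpoly_rmorph_eq => [c|k] /=.
    by rewrite /coef_x mmapC /= mmapC; apply: inj_xC.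
  rewrite coef_xX -{2}(splitK k); case: (split k) => [i|j] /=.
    by rewrite /f mmapC; apply: inj_xX.
  by rewrite /f mmapX mmap1U inj_yX.
apply: etrans (esym (gE h)) _; apply: eq_bigr => b _; congr (_ * _).
by rewrite mpolyXE_id rmorph_prod; apply: eq_bigr => j _; rewrite rmorphXn.
Qed.

Lemma coef_yK h :
  h = \sum_(a <- msupp (coef_y h)) inj_y m (coef_y h)@_a * inj_x n 'X_[a].
Proof.
pose f : {rmorphism {mpoly B[m]} -> R} :=
  mmap (@inj_y K m n) (fun i => inj_x n 'X_i).
pose g : {rmorphism R -> R} := f \o coef_y.
have gE : g =1 (idfun : {rmorphism R -> R}).
  apply: mpoly_rmorph_eq => [c|k] /=.
    by rewrite /coef_y mmapC /= mmapC; apply: inj_yC.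
  rewrite coef_yX -{2}(splitK k); case: (split k) => [i|j] /=.
    by rewrite /f mmapX mmap1U inj_xX.
  by rewrite /f mmapC; apply: inj_yX.
apply: etrans (esym (gE h)) _; apply: eq_bigr => b _; congr (_ * _).
by rewrite mpolyXE_id rmorph_prod; apply: eq_bigr => j _; rewrite rmorphXn.
Qed.

(* A rank factorization C *m D of the coefficient matrix of h writes h as a
   sum of products a_k b_k, with the a_k in the span of the coefficients of h
   over A, and the b_k in the span of those over B. *)
Lemma mixed_product_cap (I : set A) (J : set B) :
  ideal I -> ideal J ->
  mixed_product I J = extension (@inj_x K m n) I `&` extension (@inj_y K m n) J.
Proof.
move=> idI idJ; apply/seteqP; split.
  apply: ideal_mul_min => [|x y Ix Jy].
    apply: ideal_closed => [|u v [Iu Ju] [Iv Jv]|c u [Iu Ju]].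
    - by split; apply: ideal0; apply: extension_ideal.
    - by split; apply: (idealD (extension_ideal _ _)).
    - by split; apply: (idealMl _ (extension_ideal _ _)).
  by split; [apply: (idealMr _ (extension_ideal _ _))
            |apply: (idealMl _ (extension_ideal _ _))].
move=> h [/(extensionP (e := fun b => inj_y m 'X_[b]) coef_x_inj_x coef_xK _ idI) Ih].
move=> /(extensionP (e := fun a => inj_x n 'X_[a]) coef_y_inj_y coef_yK _ idJ) Jh.
pose s := in_tuple (msupp (coef_x h)).
pose d := (\sum_(b <- msupp (coef_x h)) msize (coef_x h)@_b)%N.
pose hc (i : 'I_(size (msupp (coef_x h)))) := (coef_x h)@_(tnth s i).
pose pol (v : 'rV[K]_#|{: 'X_{1..m < d}}|) : A := \sum_j v 0 j *: 'X_[enum_val j].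
have polM p q (C : 'M_(p, q)) D i :
    pol (row i (C *m D)) = \sum_k C i k *: pol (row k D).
  rewrite /pol; under eq_bigr do rewrite !mxE scaler_suml.
  rewrite exchange_big; apply: eq_bigr => k _; rewrite scaler_sumr.
  by apply: eq_bigr => j _; rewrite !mxE scalerA.
have pol_coeff v (j : 'I_#|{: 'X_{1..m < d}}|) : (pol v)@_(bmnm (enum_val j)) = v 0 j.
  rewrite raddf_sum (bigD1 j) //= mcoeffZ mcoeffX eqxx mulr1 big1 ?addr0 //.
  move=> k kj; rewrite mcoeffZ mcoeffX.
  case: eqP => [E|_]; last by rewrite mulr0.
  by case/eqP: kj; apply: enum_val_inj; apply: val_inj.
pose H := \matrix_(i < size (msupp (coef_x h)), j < #|{: 'X_{1..m < d}}|)
    (hc i)@_(bmnm (enum_val j)).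
have hcE i : hc i = pol (row i H).
  rewrite [LHS](mpolywE (k := d)); last first.
    by rewrite /d (big_tnth _ _ (msupp (coef_x h))) (bigD1 i) //= leq_addr.
  rewrite (reindex _ (onW_bij _ (@enum_val_bij _))) /=.
  by apply: eq_bigr => j _; rewrite !mxE.
pose C := col_base H; pose D := row_base H.
have HCD : H = C *m D by rewrite mulmx_base.
have [C' C'C] := row_fullP (col_base_full H).
have [D' DD'] := row_freeP (row_base_free H).
pose a k := pol (row k D); pose b k : B := \sum_i C i k *: 'X_[tnth s i].
have hE : h = \sum_k inj_x n (a k) * inj_y m (b k).
  rewrite {1}[h]coef_xK big_tnth -/s.
  under eq_bigr => i _ do rewrite -/(hc i) hcE HCD polM rmorph_sum mulr_suml.
  rewrite exchange_big; apply: eq_bigr => k _ /=.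
  rewrite [inj_y m (b k)]rmorph_sum mulr_sumr; apply: eq_bigr => i _ /=.
  by rewrite inj_xZ inj_yZ -scalerAl -scalerAr.
have Ia k : I (a k).
  have -> : a k = \sum_i C' k i *: hc i.
    rewrite /a -[D]mul1mx -C'C -mulmxA -HCD polM.
    by apply: eq_bigr => i _; rewrite hcE.
  by apply: ideal_sum => // i _; rewrite -mul_mpolyC; apply: idealMl => //; apply: Ih.
have Jb k : J (b k).
  have Jy j : J (\sum_k D k j *: b k).
    suff <- : (coef_y h)@_(bmnm (enum_val j)) = \sum_k D k j *: b k by [].
    rewrite {1}hE rmorph_sum raddf_sum /=; apply: eq_bigr => k' _.
    rewrite rmorphM /= coef_y_inj_x coef_y_inj_y mulrC mcoeffCM.
    by rewrite mcoeff_map_mpoly pol_coeff mxE mulrC mul_mpolyC.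
  have -> : b k = \sum_j D' j k *: \sum_k' D k' j *: b k'.
    under eq_bigr do rewrite scaler_sumr.
    rewrite exchange_big /=; apply: esym.
    transitivity (\sum_k' (D *m D') k' k *: b k').
      apply: eq_bigr => k' _; rewrite mxE scaler_suml.
      by apply: eq_bigr => j _; rewrite scalerA mulrC.
    rewrite DD' (bigD1 k) //= mxE eqxx scale1r big1 ?addr0 // => k' /negPf kk'.
    by rewrite mxE kk' scale0r.
  by apply: ideal_sum => // j _; rewrite -mul_mpolyC; apply: idealMl.
rewrite hE; apply: ideal_sum => [|k _]; first exact: ideal_mul_ideal.
by apply: mem_ideal_mul; apply: mem_extension.
Qed.

End MixedProduct.

(** * Resurgences of the mixed product *)

Section MixedResurgence.
Variables (K : fieldType) (m n : nat).
Variables (I : set {mpoly K[m]}) (J : set {mpoly K[n]}).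
Hypotheses (idI : ideal I) (I_neq0 : I <> [set 0]).
Hypotheses (idJ : ideal J) (J_neq0 : J <> [set 0]).

Let X := extension (@inj_x K m n) I.
Let Y := extension (@inj_y K m n) J.

Lemma mixed_product_pow s : ideal_pow (mixed_product I J) s =
  extension (@inj_x K m n) (ideal_pow I s) `&`
  extension (@inj_y K m n) (ideal_pow J s).
Proof.
rewrite -mixed_product_cap; try exact: ideal_pow_ideal.
by rewrite /mixed_product ideal_pow_mul -!extension_pow.
Qed.

(** The coefficients of b are scalars, and the leading one is a unit, so [extension_regular]
    applies. *)
Lemma inj_y_regular (L : set {mpoly K[m]}) b h : ideal L -> b != 0 ->
  extension (@inj_x K m n) L (inj_y m b * h) -> extension (@inj_x K m n) L h.
Proof.
move=> idL b0; apply: (extension_regular (@coef_x_inj_x K m n)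
  (@coef_xK K m n) idL (c := mlead b)).
rewrite /= coef_x_inj_y mcoeff_map_mpoly rmorph_unit // unitfE.
by rewrite mleadc_eq0.
Qed.

Lemma inj_x_regular (L : set {mpoly K[n]}) a h : ideal L -> a != 0 ->
  extension (@inj_y K m n) L (inj_x n a * h) -> extension (@inj_y K m n) L h.
Proof.
move=> idL a0; apply: (extension_regular (@coef_y_inj_y K m n)
  (@coef_yK K m n) idL (c := mlead a)).
rewrite /= coef_y_inj_x mcoeff_map_mpoly rmorph_unit // unitfE.
by rewrite mleadc_eq0.
Qed.

(** From right to left, a symbolic power of the product lies in both extended symbolic powers, while
    its ordinary powers are the intersections of the extended ordinary powers. *)
Lemma mixed_symbolic_subP s t :
  symbolic_pow (mixed_product I J) s `<=` ideal_pow (mixed_product I J) t <->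
  symbolic_pow I s `<=` ideal_pow I t /\ symbolic_pow J s `<=` ideal_pow J t.
Proof.
have [a Ia a0] := exists_neq0 idI I_neq0.
have [b Jb b0] := exists_neq0 idJ J_neq0.
have idX : ideal X := extension_ideal _ _.
have idY : ideal Y := extension_ideal _ _.
have ME := mixed_product_cap idI idJ.
have ME' : mixed_product I J = Y `&` X by rewrite setIC.
have powX k : ideal_pow (mixed_product I J) k =
    extension (@inj_x K m n) (ideal_pow I k) `&` ideal_pow Y k.
  by rewrite mixed_product_pow -extension_pow.
have powY k : ideal_pow (mixed_product I J) k =
    extension (@inj_y K m n) (ideal_pow J k) `&` ideal_pow X k.
  by rewrite mixed_product_pow setIC -extension_pow.
have Yb : Y (inj_y m b) by apply: mem_extension.
have Xa : X (inj_x n a) by apply: mem_extension.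
have regb L h idL := @inj_y_regular L b h idL b0.
have rega L h idL := @inj_x_regular L a h idL a0.
split=> [sub_st|[subI subJ] h hs].
  split.
    apply: (symbolic_sub_of_product (@coef_x_inj_x K m n) (@coef_xK K m n)
      idI idY powX ME Yb regb Ia _ sub_st).
    by move=> h; apply: rega.
  apply: (symbolic_sub_of_product (@coef_y_inj_y K m n) (@coef_yK K m n)
    idJ idX powY ME' Xa rega Jb _ sub_st).
  by move=> h; apply: regb.
have ext_sub (A B : comNzRingType) (f : A -> B) (L L' : set A) :
    L `<=` L' -> extension f L `<=` extension f L'.
  move=> LL'; apply: ideal_span_min => [|_ [x Lx <-]].
    exact: extension_ideal.
  by apply: mem_extension; apply: LL'.
rewrite mixed_product_pow; split.
  apply: (ext_sub _ _ _ _ _ subI).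
  exact: (symbolic_pow_sub_extension (@coef_x_inj_x K m n) (@coef_xK K m n)
      idI idY powX ME Yb regb hs).
apply: (ext_sub _ _ _ _ _ subJ).
exact: (symbolic_pow_sub_extension (@coef_y_inj_y K m n) (@coef_yK K m n)
    idJ idX powY ME' Xa rega hs).
Qed.

Lemma mixed_resurgence (F : realType) :
  resurgence F (mixed_product I J) = maxe (resurgence F I) (resurgence F J).
Proof.
apply/eqP; rewrite eq_le; apply/andP; split.
  apply: ge_ereal_sup => _ [s [t [s0 t0 sub_st ->]]].
  rewrite le_max; apply/orP.
  move: sub_st; rewrite mixed_symbolic_subP => /not_andP[Nsub|Nsub]; [left|right];
    by apply: ereal_sup_ubound; exists s, t.
rewrite ge_max; apply/andP; split; apply: ereal_sup_le => _ [s [t [s0 t0 Nsub ->]]];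
  exists s, t; split=> //; by rewrite mixed_symbolic_subP => -[].
Qed.

Lemma mixed_asymptotic_resurgence (F : realType) :
  asymptotic_resurgence F (mixed_product I J) =
    maxe (asymptotic_resurgence F I) (asymptotic_resurgence F J).
Proof.
apply/eqP; rewrite eq_le; apply/andP; split; last first.
  rewrite ge_max; apply/andP; split; apply: ereal_sup_le => _ [s [t [s0 t0 [r0 Nsub] ->]]];
    exists s, t; split=> //; exists r0 => r /Nsub;
    by apply: contra_not; rewrite mixed_symbolic_subP => -[].
apply: ge_ereal_sup => _ [s [t [s0 t0 [r0 Nsub] ->]]]; rewrite leNgt; apply/negP.
set rho := maxe _ _ => lt_rho.
(* The supremum of an empty set is -oo; in that case any number below s / t serves. *)
have [y le_y lt_y] : exists2 y : F, (rho <= y%:E)%E & y < s%:R / t%:R.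
  case: rho lt_rho => [y|//|_]; first by exists y => //; rewrite -lte_fin.
  by exists (s%:R / t%:R - 1); rewrite ?leNye // gtrBl.
(* s'/t' = s/t - 1/(N t) lies between y and s/t. *)
have d0 : 0 < s%:R / t%:R - y by rewrite subr_gt0.
pose N := (Num.bound (s%:R / t%:R - y)^-1).+2.
pose s' := (N * s).-1; pose t' := (N * t)%N.
have s'E : s'.+1 = (N * s)%N by rewrite prednK // muln_gt0 s0.
have s'_gt0 : (0 < s')%N by move: s'E; rewrite /N; lia.
have t'_gt0 : (0 < t')%N by rewrite muln_gt0 t0.
have lt_s' : (s' * t < s * t')%N.
  have : (s'.+1 * t)%N = (s * t')%N by rewrite s'E /t' mulnAC mulnC.
  by move: t0; lia.
have tF : 0 < t%:R :> F by rewrite ltr0n.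
have NF : 0 < N%:R :> F by rewrite ltr0n.
have lt_y' : y < s'%:R / t'%:R.
  have -> : s'%:R / t'%:R = s%:R / t%:R - (N%:R * t%:R)^-1 :> F.
    have -> : s'%:R = N%:R * s%:R - 1 :> F.
      by rewrite -natrM -s'E -addn1 natrD addrK.
    by rewrite /t' natrM; field; rewrite !gt_eqF.
  rewrite ltrBrDr -ltrBrDl -[X in _ < X]invrK ltf_pV2 ?posrE ?invr_gt0 ?mulr_gt0 //.
  have lt_N : (s%:R / t%:R - y)^-1 < N%:R.
    apply: lt_le_trans (archi_boundP _) _; first by rewrite invr_ge0 ltW.
    by rewrite ler_nat /N; lia.
  apply: lt_le_trans lt_N _; rewrite ler_peMr ?ler1n //.
(* The slope s'/t' exceeds the asymptotic resurgence of H, so the inclusion for (s', t') holds at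
   arbitrarily large r; [symbolic_sub_eventually] turns this into all large r for (s, t). *)
have eventually (k : nat) (H : set {mpoly K[k]}) : ideal H -> H <> [set 0] ->
    (asymptotic_resurgence F H <= rho)%E ->
    exists r1, forall r, (r1 <= r)%N ->
      symbolic_pow H (s * r) `<=` ideal_pow H (t * r).
  move=> idH H0 le_H; apply: (symbolic_sub_eventually idH H0 s0 lt_s') => r1.
  apply: contrapT => Hr1.
  suff : ((s'%:R / t'%:R)%:E <= rho)%E.
    by move=> /le_trans/(_ le_y); rewrite lee_fin leNgt lt_y'.
  apply: le_trans le_H; apply: ereal_sup_ubound; exists s', t'; split=> //.
  by exists r1 => r le_r sub_r; apply: Hr1; exists r.
have [|rI subI] := eventually _ I idI I_neq0; first by rewrite le_max lexx.
have [|rJ subJ] := eventually _ J idJ J_neq0; first by rewrite le_max lexx orbT.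
apply: (Nsub (r0 + rI + rJ)%N); first by lia.
by rewrite mixed_symbolic_subP; split; [apply: subI | apply: subJ]; lia.
Qed.

End MixedResurgence.

Theorem proposition3p5 (F : realType) (K : fieldType) (m n : nat)
    (I : set {mpoly K[m]}) (J : set {mpoly K[n]})
    (idealI : ideal I) (I_neq0 : I <> [set 0]) (I_proper : I <> setT)
    (idealJ : ideal J) (J_neq0 : J <> [set 0]) (J_proper : J <> setT) :
  resurgence F (mixed_product I J)
    = maxe (resurgence F I) (resurgence F J)
  /\
  asymptotic_resurgence F (mixed_product I J)
    = maxe (asymptotic_resurgence F I) (asymptotic_resurgence F J).
Proof.
by split; [apply: mixed_resurgence | apply: mixed_asymptotic_resurgence].
Qed.
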